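(* Let $\Omega$ be the set of irrational points of $[0,1)$, let $\mathcal{M}$ be a finite set, and for each $a\in\mathbb{N}$ let $f_a:\mathcal{M}\to\mathcal{M}$ be a function. Define $\widetilde{T}$ on $\widetilde{\Omega}=\Omega\times\mathcal{M}$ by $\widetilde{T}(x,M)=(Tx,f_{a_1(x)}(M))$. If $\widetilde{T}$ is transitive, then there exists a probability measure $\rho$ on $\widetilde{\Omega}$ that is absolutely continuous with respect to $\widetilde{\mu}$, such that $\widetilde{T}$ preserves $\rho$ and is ergodic with respect to $\rho$. Moreover, if $x\in\Omega$ is CF-normal, then for every $M\in\mathcal{M}$ the point $(x,M)$ is $\widetilde{T}$-normal with respect to $\rho$.
   Context: $T$ is the Gauss map $Tx=1/x-\lfloor1/x\rfloor$ on $[0,1)$ (with $T0=0$), $a_1(x)=\lfloor1/x\rfloor$ is the first continued fraction digit, and $\mu(A)=\int_A\frac{dx}{(\log2)(1+x)}$ is the Gauss measure. For a string $s=[c_1,\dots,c_k]$ of positive integers, $C_s=\{x\in\Omega:a_i(x)=c_i,1\le i\le k\}$ (rank $k$). A set $C_s\times\{M\}$ is a cylinder set of $\widetilde{\Omega}$, and $\widetilde{\mu}(E\times\{M\})=\mu(E)/|\mathcal{M}|$ for measurable $E\subset\Omega$. $\widetilde{T}$ is transitive if for all $M_1,M_2\in\mathcal{M}$ there is a string $s$ of positive integers of length $n$ with $\widetilde{T}^n(C_s\times\{M_1\})=\Omega\times\{M_2\}$. A point $(x,M)$ is $\widetilde{T}$-normal with respect to a measure $\rho$ if for every cylinder set $C_s\times\{M'\}$,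 $\lim_{n\to\infty}\frac1n\#\{0\le i<n:\widetilde{T}^i(x,M)\in C_s\times\{M'\}\}=\rho(C_s\times\{M'\})$. A point $x\in[0,1)$ is CF-normal if for every such string $s$, $\lim_{n\to\infty}\frac1n\#\{0\le i<n:T^ix\in C_s\}=\mu(C_s)$. *)

(* Defs.v *)
From HB Require Import structures.
From mathcomp Require Import all_boot all_order all_algebra.
From mathcomp Require Import all_classical all_reals all_analysis.
From mathcomp Require Import measurable_realfun.
Import Order.TTheory GRing.Theory Num.Theory.
Import numFieldNormedType.Exports.

Set Implicit Arguments.
Unset Strict Implicit.
Unset Printing Implicit Defensive.

Local Open Scope classical_set_scope.
Local Open Scope ring_scope.

(* A finite set with the sigma-algebra of all its subsets. The library's
   measurable types are pointed, so an (otherwise irrelevant) element [m0] has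
   to be supplied; it also records that the set is nonempty. *)
Definition discrete (M : finType) (m0 : M) : Type := M.

Section discrete_instances.
Context (M : finType) (m0 : M).
HB.instance Definition _ := Finite.copy (discrete m0) M.
HB.instance Definition _ := isPointed.Build (discrete m0) m0.
HB.instance Definition _ := @isMeasurable.Build default_measure_display
  (discrete m0) discrete_measurable discrete_measurable0
  discrete_measurableC discrete_measurableU.
End discrete_instances.

Section continued_fractions.
Context {R : realType}.

(* [Omega] is kept as a subset of the ambient type [R]. *)
Definition Omega : set R := [set x | 0 <= x < 1 /\ irrational x].

Definition gauss_map (x : R) : R :=
  if x == 0 then 0 else x^-1 - (Num.floor x^-1)%:~R.

Definition first_digit (x : R) : nat := Num.truncn x^-1.

(* The digit [digit x i] is a_(i+1)(x). *)
Definition digit (x : R) (i : nat) : nat := first_digit (iter i gauss_map x).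

Definition positive_string (s : seq nat) : bool :=
  (s != [::]) && all (fun c => (0 < c)%N) s.

Definition cyl (s : seq nat) : set R :=
  [set x | Omega x /\ forall i, (i < size s)%N -> digit x i = nth 0%N s i].

Definition gauss_density (x : R) : R := (ln 2 * (1 + x))^-1.

(* A measure on [R] concentrated on [Omega]. *)
Definition gauss (A : set R) : \bar R :=
  (\int[lebesgue_measure]_(x in A `&` Omega) (gauss_density x)%:E)%E.

Lemma measurable_Omega : measurable Omega.
Proof.
have -> : Omega = `[0, 1[%classic `\` (range ratr : set R).
  by apply/seteqP; split=> x -[x01 xi]; split=> //;
    move: x01; rewrite /= in_itv.
apply: measurableD => //; apply: countable_measurable => //.
exact: sub_countable (card_image_le _ _) _.
Qed.

Lemma gauss_density_ge0 (x : R) : Omega x -> 0 <= gauss_density x.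
Proof.
move=> -[/andP[x0 _] _]; rewrite /gauss_density invr_ge0 mulr_ge0//.
  by rewrite ln_ge0// ler1n.
by rewrite addr_ge0.
Qed.

Lemma measurable_gauss_density : measurable_fun Omega gauss_density.
Proof.
apply: (@measurable_funS _ _ _ _ (`]-1, +oo[%classic : set R)) => //.
  by move=> x -[/andP[x0 _] _] /=; rewrite in_itv /= andbT (lt_le_trans _ x0).
apply: open_continuous_measurable_fun => // x; rewrite inE /= in_itv /= andbT.
move=> x1; apply: (@continuousV R R (fun y => ln 2 * (1 + y))) => /=.
  by rewrite mulf_neq0// gt_eqF// ?ln_gt0 ?ltr1n// -ltrBlDl sub0r.
by apply: cvgM; [exact: cvg_cst | apply: cvgD; [exact: cvg_cst | exact: cvg_id]].
Qed.

Let gauss0 : gauss set0 = 0%E.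
Proof. by rewrite /gauss set0I integral_set0. Qed.

Let gauss_ge0 A : (0 <= gauss A)%E.
Proof.
by apply: integral_ge0 => x [_ Ox]; rewrite lee_fin gauss_density_ge0.
Qed.

Let gauss_sigma_additive : semi_sigma_additive gauss.
Proof.
move=> F mF tF mUF; rewrite {2}/gauss setI_bigcupl ge0_integral_bigcup//=.
- by apply: is_cvg_ereal_nneg_natsum_cond => n _ _; exact: gauss_ge0.
- by move=> k; exact: (measurableI _ _ (mF k) measurable_Omega).
- have sO : \bigcup_k (F k `&` Omega) `<=` Omega by move=> x [k _ []].
  apply: (measurable_funS measurable_Omega sO); apply/measurable_EFinP.
  exact: measurable_gauss_density.
- by move=> x [k _ [_ Ox]]; rewrite lee_fin gauss_density_ge0.
- exact: trivIset_setIr.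
Qed.

HB.instance Definition _ :=
  isMeasure.Build _ _ _ gauss gauss0 gauss_ge0 gauss_sigma_additive.

End continued_fractions.
Arguments Omega R : clear implicits.

Section frequency.
Context {R : realType} {X : Type}.

Definition frequency (g : X -> X) (x : X) (A : set X) (n : nat) : R :=
  #|[pred i : 'I_n | iter i g x \in A]|%:R / n%:R.

End frequency.
Arguments frequency R {X} g x A n.

Definition cf_normal (R : realType) (x : R) : Prop :=
  forall s, positive_string s ->
    (frequency R gauss_map x (cyl s) n)%:E @[n --> \oo] --> gauss (cyl s).

Section skew_product.
Context {R : realType} {M : finType} (m0 : M).

Local Notation space := (R * discrete m0)%type.

Definition Omegat : set space := Omega R `*` [set: discrete m0].

(* The map [f 0] plays no role: the digits of a point of [Omega] are >= 1. *)
Definition skew_map (f : nat -> M -> M) (z : space) : space :=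
  (gauss_map z.1, f (first_digit z.1) z.2).

Definition cylt (s : seq nat) (m : M) : set space := cyl s `*` [set m].

(* The measure determined by [gausst_setXset1]. *)
Definition gausst (A : set space) : \bar R :=
  (\sum_(m : M) (#|M|%:R^-1)%:E * gauss (ysection A m))%E.

Let gausst0 : gausst set0 = 0%E.
Proof.
by rewrite /gausst big1// => m _; rewrite ysection0 measure0 mule0.
Qed.

Let gausst_ge0 A : (0 <= gausst A)%E.
Proof. by apply: sume_ge0 => m _; rewrite mule_ge0// lee_fin invr_ge0. Qed.

Let gausst_sigma_additive : semi_sigma_additive gausst.
Proof.
move=> F mF tF mUF.
suff -> : gausst (\bigcup_n F n) = (\sum_(0 <= n <oo) gausst (F n))%E.
  by apply: is_cvg_ereal_nneg_natsum_cond => n _ _; exact: gausst_ge0.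
rewrite /gausst nneseries_sum; last first.
  by move=> m n _; rewrite mule_ge0// lee_fin invr_ge0.
apply: eq_bigr => m _; rewrite ysection_bigcup.
rewrite measure_bigcup//=; first last.
- exact: trivIset_ysection.
- by move=> n _; exact: measurable_ysection.
rewrite nneseriesZl//.
congr (_ * _)%E; apply: eq_eseriesl => n; exact: in_setT.
Qed.

HB.instance Definition _ :=
  isMeasure.Build _ _ _ gausst gausst0 gausst_ge0 gausst_sigma_additive.

Lemma gausst_setXset1 (E : set R) (m : M) :
  gausst (E `*` [set m]) = ((#|M|%:R^-1)%:E * gauss E)%E.
Proof.
rewrite /gausst (bigD1 m)//= big1 ?adde0; last first.
  move=> m' m'm; rewrite (_ : ysection _ _ = set0) ?measure0 ?mule0//.
  apply/seteqP; split=> x //; rewrite /ysection /= inE => -[_ /= /eqP].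
  by rewrite (negbTE m'm).
congr (_ * gauss _)%E.
by apply/seteqP; split=> x; rewrite /ysection /= inE //= => -[].
Qed.

Definition skew_transitive (f : nat -> M -> M) : Prop :=
  forall m1 m2 : M, exists2 s, positive_string s &
    iter (size s) (skew_map f) @` cylt s m1 = Omega R `*` [set m2].

(* Invariance and ergodicity of a measure concentrated on [Omegat], for [g]
   restricted to [Omegat]. *)
Definition preserves (g : space -> space) (rho : set space -> \bar R) : Prop :=
  measurable_fun Omegat g /\
  forall A, measurable A -> A `<=` Omegat ->
    rho (Omegat `&` g @^-1` A) = rho A.

Definition ergodic (g : space -> space) (rho : set space -> \bar R) : Prop :=
  forall A, measurable A -> A `<=` Omegat -> Omegat `&` g @^-1` A = A ->
    rho A = 0%E \/ rho A = 1%E.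

Definition skew_normal (f : nat -> M -> M) (rho : set space -> \bar R)
    (z : space) : Prop :=
  forall s m, positive_string s ->
    (frequency R (skew_map f) z (cylt s m) n)%:E @[n --> \oo]
      --> rho (cylt s m).

End skew_product.
Arguments Omegat R {M} m0.
Arguments skew_map R {M} m0 f z.
Arguments cylt R {M} m0 s m.
Arguments gausst R {M} m0 A.
Arguments skew_transitive R {M} m0 f.
Arguments preserves {R M m0} g rho.
Arguments ergodic {R M m0} g rho.
Arguments skew_normal {R M m0} f rho z.

(* Main.v *)
(** All branches of the Gauss map have uniformly bounded distortion, because an
    inverse branch is a Moebius map [(P + P' y) / (Q + Q' y)] with [Q' <= Q] and
    determinant 1 or -1. Hence the push-forwards of the product measure under
    the skew product stay dominated by a multiple of it, and a limit of their
    Cesaro means along an ultrafilter is an absolutely continuous invariant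
    probability [rho]. Distortion, transitivity and Knopp's density argument
    give a zero-one law for invariant sets with respect to the product measure
    itself, not only [rho]. By the Katznelson-Weiss counting argument, the
    Birkhoff sums [S_n] of a set [A] then satisfy [S_n <= q n + O(1)] almost
    everywhere with respect to the product measure, for each [q > rho A]. For a
    set determined by finitely many digits, the base points over which the
    average over a long block exceeds [q] form a set of small Gauss measure that
    is again determined by finitely many digits. A CF-normal orbit visits it
    rarely, whatever the second coordinate; averaging the block averages along
    the orbit bounds the frequency of [A] from above by [rho A]. The complement
    of [A] gives the lower bound. *)

Require Import Defs.
From HB Require Import structures.
From mathcomp Require Import all_boot all_order all_algebra.
From mathcomp Require Import all_classical all_reals all_analysis.
From mathcomp Require Import measurable_realfun ring lra zify.
Import Order.TTheory GRing.Theory Num.Theory.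
Import numFieldNormedType.Exports.
Local Open Scope classical_set_scope.
Local Open Scope ring_scope.

Set Implicit Arguments.
Unset Strict Implicit.
Unset Printing Implicit Defensive.

(** * Continued fraction digits and inverse branches *)

Local Notation positive := (all (fun c : nat => (0 < c)%N)).

Section continued_fraction_dynamics.
Context {R : realType}.
Implicit Types (x y : R) (s t : seq nat) (n c : nat).

Lemma rationalP x : rational x <-> exists q : rat, x = ratr q.
Proof. by split=> [[q _ <-]|[q ->]]; exists q. Qed.

Lemma Omega_ltr01 x : Omega R x -> 0 < x < 1.
Proof.
move=> [/andP[x0 x1] ix]; rewrite x1 andbT lt_neqAle x0 andbT.
by apply/eqP => x0'; apply: ix; apply/rationalP; exists 0; rewrite rmorph0.
Qed.

Lemma gauss_mapE x : Omega R x -> gauss_map x = x^-1 - (first_digit x)%:R.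
Proof.
move=> /Omega_ltr01 /andP[x0 x1]; rewrite /gauss_map gt_eqF// /first_digit.
have ix0 : 0 <= x^-1 by rewrite invr_ge0 ltW.
by rewrite truncn_floor ix0 [in RHS]pmulrn gez0_abs// floor_ge0.
Qed.

Lemma Omega_invB x n : irrational x -> 0 <= x^-1 - n%:R < 1 ->
  Omega R (x^-1 - n%:R).
Proof.
move=> ix h; split=> // /rationalP[q qE]; apply: ix.
apply/rationalP; exists (q + n%:R)^-1.
have qV : ratr (q + n%:R)^-1 = (ratr (q + n%:R))^-1 :> R by exact: fmorphV.
by rewrite qV rmorphD /= ratr_nat -qE subrK invrK.
Qed.

Lemma first_digit_itv x : Omega R x ->
  (first_digit x)%:R <= x^-1 < (first_digit x).+1%:R.
Proof.
move=> /Omega_ltr01 /andP[x0 x1].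
by rewrite /first_digit truncn_itv// invr_ge0 ltW.
Qed.

Lemma Omega_gauss_map x : Omega R x -> Omega R (gauss_map x).
Proof.
move=> Ox; rewrite gauss_mapE//; apply: Omega_invB; first by case: Ox.
have /andP[h1 h2] := first_digit_itv Ox.
by rewrite subr_ge0 h1 ltrBlDl -[X in _ < _ + X]/1%:R -natrD addn1.
Qed.

Lemma first_digit_gt0 x : Omega R x -> (0 < first_digit x)%N.
Proof.
move=> Ox; have /andP[x0 x1] := Omega_ltr01 Ox.
have /andP[_] := first_digit_itv Ox; case: first_digit => // /ltW.
by rewrite invf_le1// leNgt x1.
Qed.

Lemma Omega_iter x n : Omega R x -> Omega R (iter n gauss_map x).
Proof. by move=> Ox; elim: n => //= n; apply: Omega_gauss_map. Qed.

Section inverse_branch.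
Variables (y : R) (c : nat).
Hypotheses (Oy : Omega R y) (c0 : (0 < c)%N).

Let cy_gt1 : 1 < c%:R + y.
Proof.
have /andP[y0 _] := Omega_ltr01 Oy.
by rewrite (@le_lt_trans _ _ c%:R) ?ler1n ?ltrDl.
Qed.

Lemma Omega_inv : Omega R (c%:R + y)^-1.
Proof.
split; first by rewrite invr_ge0 ltW ?invf_lt1//= (lt_trans ltr01).
move=> /rationalP[q qE]; case: Oy => _; apply; apply/rationalP.
exists (q^-1 - c%:R).
have qV : ratr q^-1 = (ratr q)^-1 :> R by exact: fmorphV.
by rewrite rmorphB /= ratr_nat qV -qE invrK addrC addKr.
Qed.

Lemma first_digit_inv : first_digit (c%:R + y)^-1 = c.
Proof.
have /andP[y0 y1] := Omega_ltr01 Oy.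
rewrite /first_digit invrK; apply: truncn_def.
by rewrite lerDl ltW//= -addn1 natrD ltrD2l.
Qed.

Lemma gauss_map_inv : gauss_map (c%:R + y)^-1 = y.
Proof.
by rewrite gauss_mapE ?first_digit_inv; [rewrite invrK addrC addKr|exact: Omega_inv].
Qed.

End inverse_branch.

Lemma gauss_mapK x : Omega R x -> ((first_digit x)%:R + gauss_map x)^-1 = x.
Proof. by move=> Ox; rewrite gauss_mapE// addrC subrK invrK. Qed.

Lemma cyl_nil : cyl [::] = Omega R.
Proof. by apply/seteqP; split=> x; [case|split]. Qed.

Lemma cyl_cons c s x : cyl (c :: s) x <->
  [/\ Omega R x, first_digit x = c & cyl s (gauss_map x)].
Proof.
split=> [[Ox h]|[Ox xc [_ h]]].
  split=> //; first exact: (h 0).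
  split; first exact: Omega_gauss_map.
  by move=> i si; rewrite -[RHS](h i.+1)// /digit iterSr.
by split=> // -[|i]//= si; rewrite /digit iterSr; apply: h.
Qed.

(** The inverse of [iter (size s) gauss_map] on [cyl s]: the finite continued fraction with digits
    [s] and tail [y]. *)
Definition branch s y : R := foldr (fun c z => (c%:R + z)^-1) y s.

Lemma Omega_branch s y : positive s -> Omega R y -> Omega R (branch s y).
Proof. by elim: s => //= c s IH /andP[c0 sp] Oy; apply: Omega_inv; auto. Qed.

Lemma cyl_branch s y : positive s -> Omega R y -> cyl s (branch s y).
Proof.
elim: s => [|c s IH] /=; first by rewrite cyl_nil.
move=> /andP[c0 sp] Oy; have Ob := Omega_branch sp Oy; apply/cyl_cons; split.
- exact: Omega_inv.
- exact: first_digit_inv.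
- by rewrite gauss_map_inv//; apply: IH.
Qed.

Lemma iter_branch s y : positive s -> Omega R y ->
  iter (size s) gauss_map (branch s y) = y.
Proof.
elim: s => // c s IH /andP[c0 sp] Oy; rewrite [size _]/= iterSr.
by rewrite /= gauss_map_inv ?IH//; exact: Omega_branch.
Qed.

Lemma branch_iter s x : cyl s x -> branch s (iter (size s) gauss_map x) = x.
Proof.
elim: s x => // c s IH x /cyl_cons[Ox <- sx].
by rewrite [size _]/= iterSr /= IH// gauss_mapK.
Qed.

Lemma Omega_cyl s x : cyl s x -> Omega R x.
Proof. by case. Qed.

Definition digits n x : seq nat := mkseq (digit x) n.

Lemma size_digits n x : size (digits n x) = n.
Proof. exact: size_mkseq. Qed.

Lemma cyl_digits n x : Omega R x -> cyl (digits n x) x.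
Proof. by move=> Ox; split=> // i; rewrite size_digits => ?; rewrite nth_mkseq. Qed.

Lemma digits_cyl s x : cyl s x -> digits (size s) x = s.
Proof.
move=> [Ox h]; apply: (@eq_from_nth _ 0%N); rewrite size_digits// => i si.
by rewrite nth_mkseq// h.
Qed.

Lemma pos_digits n x : Omega R x -> positive (digits n x).
Proof.
move=> Ox; apply/allP => c /mapP[i _ ->]; apply: first_digit_gt0.
exact: Omega_iter.
Qed.

(* [branch s y = (P + P' y) / (Q + Q' y)] for [mobius s = (P, P', Q, Q')]; the
   [Q] are the continuants of the continued fraction. *)
Fixpoint mobius s : R * R * R * R :=
  if s is c :: s' then
    let: (P, P', Q, Q') := mobius s' in (Q, Q', c%:R * Q + P, c%:R * Q' + P')
  else (0, 1, 1, 0).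

(** Induction on [s]. The inequality [P' + Q' <= P + Q] is carried along because [Q' <= Q] does not
    reproduce itself: for the empty string [P' > P]. The bound [1 <= P], available for nonempty
    strings, makes [Q] grow by at least 1 per digit. Squaring the determinant hides its alternating
    sign. *)
Lemma mobiusP s : positive s -> let: (P, P', Q, Q') := mobius s in
  [/\ [/\ 1 <= Q, 0 <= Q' <= Q, 0 <= P & 0 <= P'],
      P' + Q' <= P + Q,
      (P * Q' - P' * Q) ^+ 2 = 1,
      (size s)%:R <= Q /\ (if s is [::] then true else 1 <= P) &
      forall y, 0 <= y -> branch s y = (P + P' * y) / (Q + Q' * y)].
Proof.
elim: s => [_|c s IH /= /andP[c0 /IH]] /=.
  split; rewrite ?lexx ?ler01 ?addr0 ?add0r//.
    by rewrite mul0r mul1r sub0r sqrrN expr1n.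
  by move=> y y0; rewrite mul1r mul0r add0r addr0 divr1.
case: (mobius s) => [[[P P'] Q] Q'] [[Q1 /andP[Q'0 Q'Q] P0 P'0] PQ det [sQ sP] br].
have c1 : 1 <= c%:R :> R by rewrite ler1n.
split.
- by split => //; [nra|apply/andP; split; nra|lra].
- by nra.
- by rewrite -det; ring.
- split=> //; case: s sP sQ {IH br} => [|d s] sP sQ; first by rewrite /=; nra.
  by rewrite [_.+1%:R]mulrS; nra.
- move=> y y0; rewrite br//.
  have q0 : 0 < Q + Q' * y by nra.
  have r0 : 0 < c%:R * Q + P + (c%:R * Q' + P') * y by nra.
  have -> : c%:R + (P + P' * y) / (Q + Q' * y) =
      (c%:R * Q + P + (c%:R * Q' + P') * y) / (Q + Q' * y).
    by field; rewrite gt_eqF.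
  by rewrite invf_div.
Qed.

(** By the determinant, a difference of two values of the branch is, up to sign,
    [(y - z) / ((Q + Q' * y) * (Q + Q' * z))]. Both factors lie between [Q] and [2 * Q], so
    [K = Q ^+ 2] works, and the two bounds differ by a factor 4 whatever [s] is. *)
Lemma branch_distortion s : positive s -> exists K : R,
  [/\ 1 <= K, (size s)%:R <= K,
      forall y z, 0 <= y <= 1 -> 0 <= z <= 1 ->
        `|branch s y - branch s z| <= `|y - z| / K &
      forall y z, 0 <= y <= 1 -> 0 <= z <= 1 ->
        `|y - z| <= 4 * K * `|branch s y - branch s z|].
Proof.
move=> /mobiusP; case: (mobius s) => [[[P P'] Q] Q'].
move=> [[Q1 /andP[Q'0 Q'Q] P0 P'0] PQ det [sQ _] br].
have bE y z : 0 <= y -> 0 <= z -> `|branch s y - branch s z| =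
    `|y - z| / ((Q + Q' * y) * (Q + Q' * z)).
  move=> y0 z0; have a0 : 0 < Q + Q' * y by nra.
  have b0 : 0 < Q + Q' * z by nra.
  rewrite !br//.
  have -> : (P + P' * y) / (Q + Q' * y) - (P + P' * z) / (Q + Q' * z) =
     - (P * Q' - P' * Q) * ((y - z) / ((Q + Q' * y) * (Q + Q' * z))).
    by field; rewrite !gt_eqF.
  rewrite normrM normrN normrM normfV (gtr0_norm (mulr_gt0 a0 b0)).
  have -> : `|P * Q' - P' * Q| = 1.
    have := congr1 Num.sqrt det; rewrite sqrtr_sqr sqrtr1; exact.
  by rewrite mul1r.
exists (Q ^+ 2); split.
- by nra.
- by rewrite (le_trans sQ)//; nra.
- move=> y z /andP[y0 y1] /andP[z0 z1]; rewrite bE// ler_wpM2l// lef_pV2.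
  + rewrite expr2 ler_pM//; nra.
  + by rewrite posrE mulr_gt0//; nra.
  + by rewrite posrE; nra.
- move=> y z /andP[y0 y1] /andP[z0 z1]; rewrite bE//.
  rewrite mulrA ler_pdivlMr; last by rewrite mulr_gt0//; nra.
  rewrite mulrC ler_wpM2r//.
  have -> : 4 * Q ^+ 2 = (2 * Q) * (2 * Q) by ring.
  by rewrite ler_pM//; nra.
Qed.

End continued_fraction_dynamics.

(** * Measurability of the Gauss map and of cylinders *)

Section measurability.
Context {R : realType}.

Lemma measurable_inv : measurable_fun [set: R] (@GRing.inv R).
Proof.
have -> : [set: R] = [set~ 0] `|` [set 0] by rewrite setUC setUv.
apply/measurable_funU => //; first exact: measurableC.
split; last exact: measurable_fun_set1.
apply: open_continuous_measurable_fun => [|x]; first exact/closed_openC/closed_eq.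
by rewrite inE /= => /eqP x0; exact: inv_continuous.
Qed.

Lemma measurable_truncn_nat :
  measurable_fun [set: R] (fun x => (Num.truncn x)%:R : R).
Proof.
apply: nondecreasing_measurable => // x y xy.
by rewrite ler_nat; exact: le_truncn.
Qed.

Lemma measurable_first_digit c : measurable [set x : R | first_digit x = c].
Proof.
have := measurableT_comp measurable_truncn_nat measurable_inv.
move=> /(_ measurableT [set c%:R] (measurable_set1 _)); rewrite setTI.
congr (measurable _); apply/seteqP; split=> x /=; last by rewrite /first_digit => ->.
by move=> /eqP; rewrite eqr_nat => /eqP.
Qed.

Lemma measurable_gauss_map : measurable_fun [set: R] gauss_map.
Proof.
apply: measurable_fun_if => //; first exact: measurable_fun_eqr.
apply: measurable_funB; first exact: measurable_funS measurable_inv.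
apply: (@measurable_funS _ _ _ _ setT) => //.
suff mf : measurable_fun [set: R] (fun y => (Num.floor y)%:~R : R).
  exact: (measurableT_comp mf measurable_inv).
apply: nondecreasing_measurable => // x y xy.
by rewrite ler_int; exact: le_floor.
Qed.

Lemma measurable_cyl s : measurable (@cyl R s).
Proof.
elim: s => [|c s IH]; first by rewrite cyl_nil; exact: measurable_Omega.
have -> : cyl (c :: s) = Omega R `&` [set x | first_digit x = c] `&`
    gauss_map @^-1` (cyl s).
  by apply/seteqP; split=> x; [move/cyl_cons => []|move=> [[? ?] ?]; apply/cyl_cons].
apply: measurableI; first by apply: measurableI;
  [exact: measurable_Omega|exact: measurable_first_digit].
by rewrite -[X in measurable X]setTI; exact: measurable_gauss_map.
Qed.

End measurability.

(** * Lebesgue outer measure under Lipschitz maps *)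

Section lipschitz_image.
Context {R : realType}.
Local Notation lam := (@lebesgue_measure R).

Lemma le_lebesgue_measure (A B : set R) : A `<=` B -> (lam A <= lam B)%E.
Proof. by move=> AB; exact: le_mu_ext. Qed.

Lemma lebesgue_measure_diameter (G : set R) (d : R) : 0 <= d ->
  (forall x y, G x -> G y -> x - y <= d) -> (lam G <= d%:E)%E.
Proof.
move=> d0 Gd; have [->|/set0P[a Ga]] := eqVneq G set0.
  by rewrite measure0 lee_fin.
have ubG y : G y -> ubound G (y + d).
  by move=> Gy x Gx; rewrite -lerBlDl; exact: Gd.
have GI : G `<=` `[inf G, sup G]%classic.
  move=> x Gx; rewrite /= in_itv /=; apply/andP; split.
    by apply: inf_lbound => //; exists (a - d) => y Gy;
      rewrite lerBlDr -lerBlDl; exact: Gd.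
  by apply: ub_le_sup => //; exists (a + d); exact: ubG.
apply: (le_trans (le_lebesgue_measure GI)).
rewrite lebesgue_measure_itv /=; case: ifPn => _; last by rewrite lee_fin.
rewrite lee_fin lerBlDl -lerBlDr; apply: lb_le_inf; first by exists a.
by move=> y Gy; rewrite lerBlDr; apply: ge_sup; [exists a|exact: ubG].
Qed.

(** The measure of [F] is an infimum over covers by half-open intervals. The image of the part of
    [F] in one such interval has diameter at most [L] times its length. The argument stays with
    outer measure, so [F] and [E] are arbitrary sets. *)
Lemma lebesgue_measure_lipschitz (F E : set R) (g : R -> R) (L : R) : 0 < L ->
  (forall x y, F x -> F y -> `|g x - g y| <= L * `|x - y|) ->
  E `<=` g @` F -> (lam E <= L%:E * lam F)%E.
Proof.
move=> L0 gL EgF; rewrite -lee_pdivrMl//.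
apply: le_ereal_inf_tmp => _ /= [I [mI FI] <-]; rewrite lee_pdivrMl//.
have EI : E `<=` \bigcup_k g @` (F `&` I k).
  by move=> _ /EgF[x Fx <-]; have [k _ Ik] := FI _ Fx; exists k => //; exists x.
apply: (le_trans (le_lebesgue_measure EI)).
have sub : (lam (\bigcup_k g @` (F `&` I k)) <=
    \sum_(0 <= k <oo) lam (g @` (F `&` I k)))%E.
  exact: outer_measure_sigma_subadditive.
apply: (le_trans sub).
rewrite -nneseriesZl; last by move=> k _; exact: wlength_ge0.
apply: lee_nneseries => [k _ _|k _]; first exact: measure_ge0.
have [[a b] _ /= <-] := mI k.
have [ab|ba] := leP a b; last first.
  rewrite set_itv_ge; last by rewrite bnd_simp -leNgt ltW.
  rewrite setI0 image_set0 measure0; apply: mule_ge0; first by rewrite lee_fin ltW.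
  exact: wlength_ge0.
rewrite wlength_itv_bnd// -EFinM; apply: lebesgue_measure_diameter.
  by rewrite mulr_ge0 ?subr_ge0// ltW.
move=> _ _ [x [Fx Ix] <-] [y [Fy Iy] <-]; move: Ix Iy => /=.
rewrite !in_itv /= => /andP[ax xb] /andP[ay yb].
rewrite (le_trans (ler_norm _))// (le_trans (gL _ _ Fx Fy))// ler_pM2l//.
by rewrite ler_norml; apply/andP; split; lra.
Qed.

End lipschitz_image.

(** * Invariant measures and Birkhoff sums *)

Section invariant_measure.
Context d (X : measurableType d) (R : realType) (P : probability X R).
Variables (T : X -> X) (C : R).
Hypothesis mT : measurable_fun [set: X] T.
Hypothesis PC : forall n A, measurable A ->
  (P (iter n T @^-1` A) <= C%:E * P A)%E.

Lemma measurable_preimage_iter n A : measurable A -> measurable (iter n T @^-1` A).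
Proof.
move=> mA; elim: n => // n IH.
have -> : iter n.+1 T @^-1` A = T @^-1` (iter n T @^-1` A).
  by apply/seteqP; split=> x; rewrite /preimage /= -iterSr.
by rewrite -[X in measurable X]setTI; exact: mT.
Qed.

Let p n A : R := fine (P (iter n T @^-1` A)).

Let p_ge0 n A : 0 <= p n A. Proof. by rewrite fine_ge0. Qed.

Let pE n A : measurable A -> P (iter n T @^-1` A) = (p n A)%:E.
Proof.
by move=> mA; rewrite fineK// fin_num_measure//; exact: measurable_preimage_iter.
Qed.

Let p_le1 n A : measurable A -> p n A <= 1.
Proof.
by move=> mA; rewrite -lee_fin -pE//; exact/probability_le1/measurable_preimage_iter.
Qed.

Let p_leC n A : measurable A -> p n A <= C * p 0 A.
Proof. by move=> mA; rewrite -lee_fin EFinM -!pE//; exact: PC. Qed.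

Let pT n : p n setT = 1.
Proof. by rewrite /p preimage_setT probability_setT. Qed.

Let pU n A B : measurable A -> measurable B -> A `&` B = set0 ->
  p n (A `|` B) = p n A + p n B.
Proof.
move=> mA mB AB; apply: EFin_inj; rewrite EFinD -!pE//; last exact: measurableU.
rewrite preimage_setU measureU//; try exact: measurable_preimage_iter.
by rewrite -preimage_setI AB preimage_set0.
Qed.

Let pS n A : p n (T @^-1` A) = p n.+1 A.
Proof. by rewrite /p; congr (fine (P _)); apply/seteqP; split. Qed.

Let cesaro A n : R := n.+1%:R^-1 * \sum_(i < n.+1) p i A.

Let cesaro_itv A n : measurable A -> 0 <= cesaro A n <= 1.
Proof.
move=> mA; rewrite /cesaro mulr_ge0 ?sumr_ge0 ?invr_ge0//=.
rewrite mulrC ler_pdivrMr// mul1r.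
have : \sum_(i < n.+1) p i A <= \sum_(i < n.+1) 1.
  by apply: ler_sum => i _; exact: p_le1.
by rewrite sumr_const card_ord.
Qed.

Let cesaro_leC A n : measurable A -> cesaro A n <= C * p 0 A.
Proof.
move=> mA; rewrite /cesaro mulrC ler_pdivrMr//.
have : \sum_(i < n.+1) p i A <= \sum_(i < n.+1) (C * p 0 A).
  by apply: ler_sum => i _; exact: p_leC.
by rewrite sumr_const card_ord mulr_natr.
Qed.

Let cesaroU A B n : measurable A -> measurable B -> A `&` B = set0 ->
  cesaro (A `|` B) n = cesaro A n + cesaro B n.
Proof.
move=> mA mB AB; rewrite /cesaro -mulrDr -big_split /=; congr (_ * _).
by apply: eq_bigr => i _; exact: pU.
Qed.

Let cesaroT n : cesaro setT n = 1.
Proof.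
rewrite /cesaro (eq_bigr (fun=> 1)); last by move=> i _; exact: pT.
by rewrite sumr_const card_ord mulVf.
Qed.

(** The two sums telescope to [p n.+1 A - p 0 A], a difference of two numbers in $[0,1]$. *)
Let cesaro_shift A n : measurable A ->
  `|cesaro (T @^-1` A) n - cesaro A n| <= n.+1%:R^-1.
Proof.
move=> mA; rewrite /cesaro -mulrBr normrM ger0_norm ?invr_ge0//.
rewrite -[leRHS]mulr1 ler_wpM2l ?invr_ge0//.
rewrite (eq_bigr (fun i : 'I_n.+1 => p i.+1 A)) => [|i _]; last exact: pS.
rewrite big_ord_recr big_ord_recl /=.
rewrite [X in _ - (_ + X)](eq_bigr (fun i : 'I_n => p i.+1 A))//.
set S := \sum_(i < n) _.
rewrite (_ : S + _ - _ = p n.+1 A - p 0 A); last by ring.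
rewrite ler_norml; have := p_ge0 n.+1 A; have := p_ge0 0 A.
have := p_le1 n.+1 mA; have := p_le1 0 mA; lra.
Qed.

(* Along an ultrafilter the Cesaro means of the push-forwards of [P] converge to
   an invariant content; domination by [C * P] makes it sigma-additive. *)
Lemma invariant_measure : exists rho : probability X R,
  (forall A, measurable A -> rho (T @^-1` A) = rho A) /\
  (forall A, measurable A -> (rho A <= C%:E * P A)%E).
Proof.
have [U [UU Uoo]] := @ultraFilterLemma nat \oo _.
have PU := @ultra_proper _ _ UU.
(* The means lie in the compact interval $[0,1]$, and an ultrafilter converges to each of its
   cluster points. *)
have cvU (A : set X) : measurable A -> exists l : R, cesaro A n @[n --> U] --> l.
  move=> mA; have [|l [_ cl]] := @segment_compact R 0 1 (cesaro A n @[n --> U]) _.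
    suff : U (cesaro A @^-1` `[0, 1]) by [].
    apply: filterS filterT => n _.
    by rewrite /preimage /= in_itv /=; exact: cesaro_itv.
  exists l => V Vl; have [//|UV] := in_ultra_setVsetC (cesaro A @^-1` V) UU.
  by have [x []] := cl (~` V) V UV Vl.
(* The default value 0 keeps [L] nonnegative on all sets, as the measure structure demands. *)
pose L (A : set X) : R :=
  if `[< measurable A >] then lim (cesaro A n @[n --> U]) else 0.
have LE : forall A : set X, measurable A -> cesaro A n @[n --> U] --> L A.
  move=> A mA; have [l cl] := cvU _ mA.
  by rewrite /L asboolT// (cvg_lim _ cl).
have near_true (Q : nat -> Prop) : (forall n, Q n) -> \forall n \near U, Q n.
  by move=> h; apply: filterS filterT => n _.
have L_ge0 (A : set X) : 0 <= L A.
  have [mA|nmA] := pselect (measurable A); last by rewrite /L asboolF.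
  apply: (cvgr_to_ge (LE _ mA)); apply: near_true => n.
  by have /andP[] := cesaro_itv n mA.
have L_leC (A : set X) : measurable A -> L A <= C * p 0 A.
  move=> mA; apply: (cvgr_to_le (LE _ mA)); apply: near_true => n.
  exact: cesaro_leC.
have LU (A B : set X) : measurable A -> measurable B -> A `&` B = set0 ->
    L (A `|` B) = L A + L B.
  move=> mA mB AB; have mAB := measurableU _ _ mA mB.
  apply: (cvg_unique _ (LE _ mAB)) => //.
  rewrite (_ : (fun n => _) = (fun n => cesaro A n + cesaro B n)).
    by apply: cvgD; exact: LE.
  by apply/funext => n; exact: cesaroU.
have LT : L setT = 1.
  apply: (cvg_unique _ (LE _ measurableT)) => //.
  rewrite (_ : (fun n => _) = cst 1); first exact: cvg_cst.
  by apply/funext => n; exact: cesaroT.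
have L0 : L set0 = 0.
  have := LU _ _ (@measurable0 _ X) (@measurable0 _ X) (setI0 _).
  by rewrite setU0 => /eqP; rewrite -subr_eq0 opprD addNKr oppr_eq0 => /eqP.
have Linv (A : set X) : measurable A -> L (T @^-1` A) = L A.
  move=> mA; have mTA : measurable (T @^-1` A) by exact: (measurable_preimage_iter 1).
  have cD : (cesaro (T @^-1` A) n - cesaro A n) @[n --> U] --> L (T @^-1` A) - L A.
    by apply: cvgB; exact: LE.
  (* This limit holds along [\oo], hence along the finer filter [U], where limits are unique. *)
  have c0 : (cesaro (T @^-1` A) n - cesaro A n) @[n --> \oo] --> (0 : R).
    apply/norm_cvg0P; apply: (@squeeze_cvgr _ _ _ _ (cst 0) (fun n => n.+1%:R^-1)).
    - by apply: nearW => n; rewrite normr_ge0 cesaro_shift.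
    - exact: cvg_cst.
    - exact: cvg_harmonic.
  apply/eqP; rewrite -subr_eq0; apply/eqP.
  apply: (cvg_unique _ cD) => //.
  by apply: cvg_trans c0; apply: cvg_app.
pose rho (A : set X) := (L A)%:E.
have rho0 : rho set0 = 0%E by rewrite /rho L0.
have rho_ge0 (A : set X) : (0 <= rho A)%E by rewrite lee_fin.
have rho_sa : semi_sigma_additive rho.
  move=> F mF tF mUF.
  (* Finite additivity leaves the content of the tail as remainder. The tails decrease to the empty
     set, so their [P]-measure tends to 0, and domination by [C * P] carries this over to [L]. *)
  pose tail n := \bigcup_(i in [set i | (n <= i)%N]) F i.
  have mtail n : measurable (tail n) by exact: bigcup_measurable.
  have tailS n : tail n = F n `|` tail n.+1.
    apply/seteqP; split=> x.
      move=> [i /= ni Fi]; move: ni; rewrite leq_eqVlt => /predU1P[->|ni].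
        by left.
      by right; exists i.
    by move=> [Fn|[i /= ni Fi]]; [exists n => /=|exists i => //=; exact: ltnW].
  have FItail n : F n `&` tail n.+1 = set0.
    apply/seteqP; split=> // x [Fn [i /= ni Fi]].
    have := tF n i I I (ex_intro _ x (conj Fn Fi)) => ni'.
    by rewrite ni' ltnn in ni.
  have Lsum n : L (\bigcup_i F i) = \sum_(0 <= i < n) L (F i) + L (tail n).
    elim: n => [|n IH].
      rewrite big_geq// add0r; congr L; apply/seteqP.
      by split=> x [i _ Fi]; exists i.
    by rewrite IH big_nat_recr//= -addrA -LU// -tailS.
  have Ptail : (P \o tail) n @[n --> \oo] --> P (\bigcap_n tail n).
    apply: nonincreasing_cvg_mu => //.
    - by rewrite ltey_eq fin_num_measure.
    - exact: bigcap_measurable.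
    - move=> n m nm; apply/subsetPset => x [i /= mi Fi]; exists i => //=.
      exact: leq_trans mi.
  have tail0 : \bigcap_n tail n = set0.
    apply/seteqP; split=> // x tx; have [i _ Fi] := tx 0%N I.
    have [j /= ij Fj] := tx i.+1 I.
    have ij' := tF i j I I (ex_intro _ x (conj Fi Fj)).
    by rewrite ij' ltnn in ij.
  have ptail : p 0 (tail n) @[n --> \oo] --> (0 : R).
    by apply: fine_cvg; rewrite tail0 measure0 in Ptail.
  have Ltail : L (tail n) @[n --> \oo] --> (0 : R).
    apply: (@squeeze_cvgr _ _ _ _ (cst 0) (fun n => C * p 0 (tail n))).
    - by apply: nearW => n; rewrite L_ge0 L_leC.
    - exact: cvg_cst.
    - by rewrite -[X in _ --> X](mulr0 C); apply: cvgMr.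
  rewrite /rho; under eq_fun do rewrite sumEFin.
  apply: cvg_EFin; first by apply: nearW.
  rewrite (_ : _ \o _ = (fun n => L (\bigcup_i F i) - L (tail n))); last first.
    by apply/funext => n; rewrite /= (Lsum n) addrK.
  by rewrite -[X in _ --> X]subr0; apply: cvgB => //; exact: cvg_cst.
(* The total mass is already 1, so [mnormalize] leaves the values unchanged and only supplies the
   probability structure. *)
pose rhoM := isMeasure.Build _ _ _ rho rho0 rho_ge0 rho_sa.
pose rho' : {measure set X -> \bar R} := HB.pack rho rhoM.
have rhoT : rho' setT = 1%E by rewrite /= /rho LT.
have rhoE A : mnormalize rho' P A = rho A.
  by rewrite /mnormalize rhoT onee_eq0 /= invr1 mule1.
exists (mnormalize rho' P); split=> A mA.
  by apply: (etrans (rhoE _)); apply: (etrans _ (esym (rhoE _))); rewrite /rho Linv.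
rewrite [leLHS]rhoE.
by rewrite /rho -[A in P A]/(iter 0 T @^-1` A) pE// -EFinM lee_fin L_leC.
Qed.

End invariant_measure.

(** * Birkhoff sums along a single orbit *)

Section birkhoff_sums.
Context {X : Type} {R : realType}.
Variables (T : X -> X).
Implicit Types (A : set X) (z : X) (n : nat).

Definition birkhoff A n z : R := \sum_(i < n) \1_A (iter i T z).

Lemma birkhoff0 A z : birkhoff A 0 z = 0.
Proof. by rewrite /birkhoff big_ord0. Qed.

Lemma birkhoffS A n z : birkhoff A n.+1 z = \1_A z + birkhoff A n (T z).
Proof.
rewrite /birkhoff big_ord_recl; congr (_ + _).
by apply: eq_bigr => i _; rewrite -iterSr.
Qed.

Lemma birkhoffD A n m z : birkhoff A (n + m) z =
  birkhoff A n z + birkhoff A m (iter n T z).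
Proof.
elim: n z => [|n IH] z; first by rewrite birkhoff0 add0r.
by rewrite addSn !birkhoffS IH addrA iterSr.
Qed.

Lemma birkhoff_ge0 A n z : 0 <= birkhoff A n z.
Proof. by apply: sumr_ge0 => i _; rewrite indicE. Qed.

Lemma birkhoff_le A n z : birkhoff A n z <= n%:R.
Proof.
rewrite -[n in leRHS]card_ord -sumr_const; apply: ler_sum => i _.
by rewrite indicE; case: (_ \in _).
Qed.

Lemma birkhoffC A n z : birkhoff (~` A) n z = n%:R - birkhoff A n z.
Proof.
apply/eqP; rewrite eq_sym subr_eq -big_split /= -[n in n%:R]card_ord -sumr_const.
apply/eqP; apply: eq_bigr => i _; rewrite !indicE in_setC.
by case: (_ \in _); rewrite ?add0r ?addr0.
Qed.

Lemma frequencyE A n z : frequency R T z A n = birkhoff A n z / n%:R.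
Proof.
rewrite /frequency; congr (_ / _); rewrite -sum1_card natr_sum /birkhoff.
by rewrite big_mkcond; apply: eq_bigr => i _; rewrite indicE inE; case: ifP.
Qed.

(** Summing the block sums over [N] starting points gives the [n] shifted sums
    [birkhoff A N (iter i T z)] with [i < n]. Each shift loses at most [i <= n] visits, whence the
    error [n ^+ 2]. *)
Lemma birkhoff_average A n N z :
  n%:R * birkhoff A N z <=
  n%:R ^+ 2 + \sum_(j < N) birkhoff A n (iter j T z) :> R.
Proof.
elim: n => [|n IH].
  by rewrite mul0r addr_ge0 ?sqr_ge0// sumr_ge0// => j _; exact: birkhoff_ge0.
have -> : \sum_(j < N) birkhoff A n.+1 (iter j T z) =
    \sum_(j < N) birkhoff A n (iter j T z) + birkhoff A N (iter n T z) :> R.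
  rewrite [X in _ = _ + X]/birkhoff -big_split /=; apply: eq_bigr => j _.
  by rewrite -addn1 birkhoffD birkhoffS birkhoff0 addr0 -!iterD addnC.
have := birkhoffD A N n z; rewrite addnC birkhoffD.
have := birkhoff_ge0 A n (iter N T z).
have := birkhoff_le A n z.
have n0 : 0 <= n%:R :> R by [].
rewrite -addn1 natrD; nra.
Qed.

(* A block decomposition of the orbit: from a point of [D] jump along the block
   on which the average exceeds [q], from any other point move one step. *)
Lemma birkhoff_cover A D (q : R) N L z : 0 <= q -> q <= 1 ->
  D `<=` [set y | exists2 n, (n <= N)%N & q * n%:R < birkhoff A n y] ->
  q * L%:R <= birkhoff A L z + birkhoff (~` D) L z + q * N%:R.
Proof.
move=> q0 q1 DE; have [k] := ubnP L; elim: k L z => // k IH L z; rewrite ltnS => Lk.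
(* A remaining stretch no longer than a block is paid for by the term [q * N%:R]. *)
have [LN|NL] := leqP L N.
  have := birkhoff_ge0 A L z; have := birkhoff_ge0 (~` D) L z.
  have : q * L%:R <= q * N%:R by rewrite ler_wpM2l// ler_nat.
  lra.
have [/DE[n nN qn]|nD] := pselect (D z).
  (* The strict inequality in [D] excludes the empty block, so the jump makes progress. *)
  have n0 : (0 < n)%N by case: n qn {nN} => //; rewrite mulr0 birkhoff0 ltxx.
  have -> : L = (n + (L - n))%N by rewrite subnKC// (leq_trans nN)// ltnW.
  rewrite !birkhoffD natrD.
  have := IH (L - n)%N (iter n T z); have := birkhoff_ge0 (~` D) n z.
  have lt : (L - n < k)%N by lia.
  by move=> h /(_ lt); lra.
(* Outside [D] a single step costs [q <= 1], covered by the visit to the complement of [D]. *)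
case: L NL Lk => // L _ Lk; rewrite !birkhoffS.
have := IH L (T z) Lk.
have -> : \1_(~` D) z = 1 :> R by rewrite indicE mem_set.
have : 0 <= \1_A z :> R by rewrite indicE.
by rewrite -addn1 natrD; lra.
Qed.

End birkhoff_sums.

(** * From frequent visits to a lower bound on an invariant measure *)

Section frequent_visits.
Context d (X : measurableType d) (R : realType) (rho : probability X R).
Variables (T : X -> X).
Hypothesis mT : measurable_fun [set: X] T.
Hypothesis invT : forall A, measurable A -> rho (T @^-1` A) = rho A.

Lemma measurable_birkhoff A n : measurable A ->
  measurable_fun [set: X] (birkhoff T A n : X -> R).
Proof.
move=> mA; apply: measurable_sum => i.
rewrite (_ : (fun x => _) = \1_(iter i T @^-1` A)); last first.
  by apply/funext => x; rewrite !indicE.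
by apply: measurable_indic; exact: measurable_preimage_iter.
Qed.

Lemma measurable_birkhoff_gt A n (r : R) : measurable A ->
  measurable [set z | r < birkhoff T A n z].
Proof.
move=> mA; have := measurable_birkhoff n mA measurableT (measurable_itv `]r, +oo[).
rewrite setTI; congr (measurable _).
by apply/seteqP; split=> z /=; rewrite in_itv /= andbT.
Qed.

Lemma measure_preimage_iter A n : measurable A -> rho (iter n T @^-1` A) = rho A.
Proof.
move=> mA; elim: n => // n IH; rewrite -IH -(invT (measurable_preimage_iter mT n mA)).
by congr (rho _); apply/seteqP; split=> x; rewrite /preimage /= -iterSr.
Qed.

Lemma integral_birkhoff A n : measurable A ->
  (\int[rho]_z (birkhoff T A n z)%:E = n%:R%:E * rho A)%E.
Proof.
move=> mA; under eq_integral do rewrite /birkhoff -sumEFin.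
have E i : (fun x => \1_A (iter i T x) : R) = \1_(iter i T @^-1` A).
  by apply/funext => x; rewrite !indicE.
have m i : measurable_fun [set: X] (fun x => (\1_A (iter i T x) : R)%:E).
  apply/measurable_EFinP; rewrite E; apply: measurable_indic.
  exact: measurable_preimage_iter.
have p i x : [set: X] x -> (0 <= (\1_A (iter i T x) : R)%:E)%E.
  by move=> _; rewrite lee_fin indicE.
rewrite ge0_integral_sum//.
rewrite (eq_bigr (fun=> rho A)) => [|i _].
  rewrite -(fineK (fin_num_measure rho _ mA)) sumEFin sumr_const card_ord.
  by rewrite -(mulr_natl (fine _)) EFinM.
rewrite -(measure_preimage_iter i mA) -[in RHS](setIT (iter i T @^-1` A)).
by rewrite -integral_indic//; last exact: measurable_preimage_iter.
Qed.

Lemma frequent_visits A (q : R) : measurable A -> 0 <= q ->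
  rho [set z | exists n, q * n%:R < birkhoff T A n z] = 1%E -> (q%:E <= rho A)%E.
Proof.
move=> mA q0 D1.
pose D N := [set z | exists2 n, (n <= N)%N & q * n%:R < birkhoff T A n z].
have mD N : measurable (D N).
  rewrite (_ : D N = \bigcup_(n in [set n | (n <= N)%N])
      [set z | q * n%:R < birkhoff T A n z]).
    by apply: bigcup_measurable => n _; exact: measurable_birkhoff_gt.
  by apply/seteqP; split=> z [n nN zn]; exists n.
have DE : [set z | exists n, q * n%:R < birkhoff T A n z] = \bigcup_N D N.
  apply/seteqP; split=> z; first by move=> [n zn]; exists n => //; exists n.
  by move=> [N _ [n _ zn]]; exists n.
(* A set of measure 1 has a point, and no average of an indicator exceeds 1. *)
have q1 : q <= 1.
  have [D0|/set0P[z [n zn]]] :=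
      eqVneq [set z | exists n, q * n%:R < birkhoff T A n z] set0.
    by move: D1; rewrite D0 measure0 => /eqP; rewrite eq_sym onee_eq0.
  have := lt_le_trans zn (birkhoff_le _ _ _ _).
  case: n zn => [|n _]; first by rewrite mulr0 birkhoff0 ltxx.
  by rewrite -ltr_pdivlMr// divff// => /ltW.
have [a aE] : exists a, rho A = a%:E.
  by exists (fine (rho A)); rewrite fineK// fin_num_measure.
have key N : (rho (D N) <= (a + 1 - q)%:E)%E.
  have [b bE] : exists b, rho (~` D N) = b%:E.
    exists (fine (rho (~` D N))); rewrite fineK// fin_num_measure//.
    exact: measurableC.
  have -> : rho (D N) = (1 - b)%:E.
    rewrite -[D N]setCK probability_setC ?bE//; exact: measurableC.
  rewrite lee_fin; suff : q <= a + b by lra.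
  have hL L : q * L%:R <= L%:R * (a + b) + q * N%:R.
    have mDC : measurable (~` D N) by exact: measurableC.
    have cst_int (r : R) : (\int[rho]_z r%:E = r%:E)%E.
      rewrite (integral_cst rho measurableT) -[RHS]mule1; congr (_ * _)%E.
      exact: probability_setT.
    rewrite -lee_fin -cst_int.
    have -> : (L%:R * (a + b) + q * N%:R)%:E = (\int[rho]_z
        ((birkhoff T A L z)%:E + (birkhoff T (~` D N) L z)%:E + (q * N%:R)%:E))%E.
      have mfA : measurable_fun setT (fun z => (birkhoff T A L z : R)%:E).
        by apply/measurable_EFinP; exact: measurable_birkhoff.
      have mfD : measurable_fun setT (fun z => (birkhoff T (~` D N) L z : R)%:E).
        by apply/measurable_EFinP; exact: measurable_birkhoff.
      have pA z : [set: X] z -> (0 <= (birkhoff T A L z : R)%:E)%E.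
        by rewrite lee_fin birkhoff_ge0.
      have pD z : [set: X] z -> (0 <= (birkhoff T (~` D N) L z : R)%:E)%E.
        by rewrite lee_fin birkhoff_ge0.
      have pAD z : [set: X] z ->
          (0 <= (birkhoff T A L z : R)%:E + (birkhoff T (~` D N) L z : R)%:E)%E.
        by move=> zT; rewrite adde_ge0 ?pA ?pD.
      have pq z : [set: X] z -> (0 <= (q * N%:R)%:E)%E.
        by rewrite lee_fin mulr_ge0.
      rewrite (ge0_integralD rho measurableT pAD (emeasurable_funD mfA mfD) pq)//.
      rewrite (ge0_integralD rho measurableT pA mfA pD mfD).
      by rewrite !integral_birkhoff// cst_int aE bE -!EFinM -!EFinD mulrDr.
    apply: ge0_le_integral => //.
    - by move=> z _; rewrite lee_fin mulr_ge0.
    - by apply: emeasurable_funD => //; apply: emeasurable_funD; apply/measurable_EFinP;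
        exact: measurable_birkhoff.
    - move=> z _; rewrite -!EFinD lee_fin; exact: birkhoff_cover.
  rewrite leNgt; apply/negP => abq.
  (* If the inequality failed, a stretch of length [L > q * N / (q - (a + b))] would contradict
     [hL]. *)
  have x0 : 0 < q - (a + b) by lra.
  have := hL (Num.truncn (q * N%:R / (q - (a + b)))).+1.
  have := truncnS_gt (q * N%:R / (q - (a + b))).
  by rewrite ltr_pdivrMr//; lra.
rewrite aE lee_fin; suff : (1 <= a + 1 - q) by lra.
rewrite -lee_fin -[leLHS]D1 DE.
have cv : rho (D N) @[N --> \oo] --> rho (\bigcup_N D N).
  apply: nondecreasing_cvg_mu => //; first exact: bigcup_measurable.
  move=> n m nm; apply/subsetPset => z [i im zi]; exists i => //.
  exact: leq_trans nm.
rewrite -(cvg_lim _ cv)//; apply: lime_le; first exact: cvgP cv.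
exact: nearW.
Qed.

End frequent_visits.

(** * Gauss and Lebesgue measure on cylinders *)

Section gauss_measure.
Context {R : realType}.
Local Notation lam := (@lebesgue_measure R).
Implicit Types E : set R.

Let measurable_rational : measurable (rational : set R).
Proof.
apply: countable_measurable => //.
exact: sub_countable (card_image_le _ _) _.
Qed.

Let Omega_itv : Omega R = `[0, 1]%classic `\` (rational : set R).
Proof.
apply/seteqP; split=> x; rewrite /= in_itv /=.
  by move=> Ox; have /andP[x0 x1] := Omega_ltr01 Ox; case: Ox => _ ix; rewrite !ltW.
move=> [/andP[x0 x1] ix]; split=> //; rewrite x0 lt_neqAle x1 andbT.
by apply/eqP => x1E; apply: ix; apply/rationalP; exists 1; rewrite rmorph1.
Qed.

Lemma lebesgue_measure_Omega : lam (Omega R) = 1%E.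
Proof.
have m01 : measurable (`[0, 1]%classic : set R) by [].
have mI := measurableI _ _ m01 measurable_rational.
have I0 : lam ((`[0, 1]%classic : set R) `&` rational) = 0%E.
  exact: (@subset_measure0 _ _ _ lam _ _ mI measurable_rational (@subIsetr _ _ _)
    (lebesgue_measure_rat R)).
have <- : lam (`[0, 1]%classic : set R) = 1%E.
  by rewrite lebesgue_measure_itv /= lte_fin ltr01 oppr0 adde0.
have -> : lam (`[0, 1]%classic : set R) =
    (lam (Omega R) + lam ((`[0%R, 1%R]%classic : set R) `&` rational))%E.
  by rewrite Omega_itv; exact: (measureDI lam m01 measurable_rational).
by rewrite I0 adde0.
Qed.

Let ln2_gt0 : 0 < ln 2 :> R.
Proof. by rewrite ln_gt0// ltr1n. Qed.

Lemma gauss_density_itv (x : R) : Omega R x ->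
  (2 * ln 2)^-1 <= gauss_density x <= (ln 2)^-1.
Proof.
move=> /Omega_ltr01 /andP[x0 x1]; rewrite /gauss_density.
have h : 0 < 1 + x by lra.
apply/andP; split; rewrite lef_pV2 ?posrE ?mulr_gt0//.
  by rewrite (mulrC 2) ler_pM2l//; lra.
by rewrite ler_peMr ?(ltW ln2_gt0)//; lra.
Qed.

Let continuous_gauss_density (x : R) : -1 < x -> {for x, continuous (@gauss_density R)}.
Proof.
move=> x1; apply: (@continuousV R R (fun y => ln 2 * (1 + y))) => /=.
  by rewrite mulf_neq0// gt_eqF// -ltrBlDl sub0r.
by apply: cvgM; [exact: cvg_cst | apply: cvgD; [exact: cvg_cst | exact: cvg_id]].
Qed.

Let measurable_density E : measurable E ->
  measurable_fun (E `&` Omega R) (fun x => (gauss_density x)%:E).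
Proof.
move=> mE; apply/measurable_EFinP.
apply: (measurable_funS measurable_Omega) => //.
exact: measurable_gauss_density.
Qed.

Lemma gauss_le_lebesgue E : measurable E ->
  (gauss E <= (ln 2)^-1%:E * lam (E `&` Omega R))%E.
Proof.
move=> mE; have mEO := measurableI _ _ mE measurable_Omega.
rewrite -(integral_cst lam mEO) /gauss.
apply: ge0_le_integral => //.
- by move=> x [_ Ox]; rewrite lee_fin gauss_density_ge0.
- exact: measurable_density.
- by move=> x [_ /gauss_density_itv/andP[_]]; rewrite lee_fin.
Qed.

Lemma lebesgue_le_gauss E : measurable E ->
  (lam (E `&` Omega R) <= (2 * ln 2)%:E * gauss E)%E.
Proof.
move=> mE; have mEO := measurableI _ _ mE measurable_Omega.
have c0 : 0 < 2 * ln 2 :> R by rewrite mulr_gt0.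
rewrite -lee_pdivrMl// -(integral_cst lam mEO) /gauss.
apply: ge0_le_integral => //.
- by move=> x _; rewrite lee_fin invr_ge0 ltW.
- exact: measurable_density.
- by move=> x [_ /gauss_density_itv/andP[+ _]]; rewrite lee_fin.
Qed.

(** The rationals are null, so the integral runs over $[0,1]$, where $\log(1+x)/\log 2$ is an
    antiderivative. *)
Lemma gauss_Omega : gauss (Omega R) = 1%E.
Proof.
rewrite /gauss setIid Omega_itv -ge0_negligible_integral//.
- pose F x : R := (ln 2)^-1 * ln (1 + x).
  have dF (x : R) : -1 < x -> is_derive x (1 : R) F (gauss_density x).
    move=> x1; have h : 0 < 1 + x by lra.
    have dl : is_derive (1 + x) (1 : R) (@ln R) (1 + x)^-1 by exact: is_derive1_ln.
    have d1 : is_derive x (1 : R) (fun y : R => 1 + y) (0 + 1).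
      exact: is_deriveD.
    have dc := is_derive1_comp dl d1.
    have := @is_deriveZ _ _ _ _ (ln 2)^-1 _ _ _ dc.
    rewrite add0r mulr1 /gauss_density invfM; exact.
  have cF (x : R) : -1 < x -> {for x, continuous F}.
    move=> /dF dx; apply: differentiable_continuous; apply/derivable1_diffP.
    exact: ex_derive.
  rewrite (@continuous_FTC2 _ _ F)//.
  + rewrite /F addr0 ln1 mulr0 sube0 mulVf//; exact: lt0r_neq0.
  + apply: continuous_in_subspaceT => x; rewrite inE /= in_itv /= => /andP[x0 _].
    by apply: continuous_gauss_density; lra.
  + split.
    * move=> x; rewrite in_itv /= => /andP[x0 _].
      by apply: ex_derive; apply: dF; lra.
    * by apply: cvg_at_right_filter; apply: cF; lra.
    * by apply: cvg_at_left_filter; apply: cF; lra.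
  + move=> x; rewrite in_itv /= => /andP[x0 _].
    by rewrite derive1E; apply: derive_val; apply: dF; lra.
- apply/measurable_EFinP.
  apply: (@measurable_funS _ _ _ _ (`]-1, +oo[%classic : set R)) => //.
    by move=> x; rewrite /= !in_itv /= => /andP[x0 _]; rewrite andbT; lra.
  apply: open_continuous_measurable_fun => // x; rewrite inE /= in_itv /= andbT.
  exact: continuous_gauss_density.
- move=> x; rewrite /= in_itv /= => /andP[x0 _].
  by rewrite lee_fin invr_ge0 mulr_ge0 ?(ltW ln2_gt0)//; lra.
- exact: lebesgue_measure_rat.
Qed.

Lemma gauss_setIOmega E : gauss (E `&` Omega R) = gauss E.
Proof. by rewrite /gauss -setIA setIid. Qed.

Lemma gauss_fin_num E : measurable E -> gauss E \is a fin_num.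
Proof.
move=> mE; rewrite ge0_fin_numE ?measure_ge0// -gauss_setIOmega.
apply: (@le_lt_trans _ _ (gauss (Omega R))); last by rewrite gauss_Omega ltry.
apply: le_measure; rewrite ?inE; [|exact: measurable_Omega|exact: subIsetr].
by apply: measurableI => //; exact: measurable_Omega.
Qed.

End gauss_measure.

(** * Bounded distortion of Lebesgue measure on cylinders *)

Section distortion.
Context {R : realType}.
Local Notation lam := (@lebesgue_measure R).
Local Notation T := (@gauss_map R).
Implicit Types (s : seq nat) (E W B : set R) (n : nat).

Lemma Omega_itv01 (x : R) : Omega R x -> 0 <= x <= 1.
Proof. by move=> /Omega_ltr01/andP[x0 x1]; rewrite !ltW. Qed.

(** Both bounds are Lipschitz estimates, one for the inverse branch and one for the iterate on the
    cylinder. A single [K] serves all [E], so that comparison with [E = Omega] can eliminate it. *)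
Lemma lebesgue_measure_branch s : positive s -> exists K : R,
  0 < K /\ forall E, E `<=` Omega R ->
  (lam (cyl s `&` iter (size s) T @^-1` E) <= K^-1%:E * lam E)%E /\
  (lam E <= (4 * K)%:E * lam (cyl s `&` iter (size s) T @^-1` E))%E.
Proof.
move=> sp; have [K [K1 _ up lo]] := @branch_distortion R _ sp.
have K0 : 0 < K by exact: lt_le_trans K1.
exists K; split=> // E EO; split.
- apply: (@lebesgue_measure_lipschitz _ _ _ (branch s)).
  + by rewrite invr_gt0.
  + by move=> x y /EO/Omega_itv01 x01 /EO/Omega_itv01 y01; rewrite mulrC; exact: up.
  + move=> x [sx Ex]; exists (iter (size s) T x) => //; exact: branch_iter.
- apply: (@lebesgue_measure_lipschitz _ _ _ (iter (size s) T)).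
  + by rewrite mulr_gt0.
  + move=> x y [sx /EO/Omega_itv01 x01] [sy /EO/Omega_itv01 y01].
    by rewrite -{2}(branch_iter sx) -{2}(branch_iter sy); exact: lo.
  + move=> y Ey; exists (branch s y); last by rewrite iter_branch//; exact: EO.
    split; first by apply: cyl_branch => //; exact: EO.
    by rewrite /preimage /= iter_branch//; exact: EO.
Qed.

Lemma cyl_preimage_Omega s : cyl s `&` iter (size s) T @^-1` Omega R = cyl s.
Proof.
apply/seteqP; split=> x; first by case.
by move=> sx; split=> //; exact/Omega_iter/(Omega_cyl sx).
Qed.

Lemma lebesgue_measure_cyl_gt0 s : positive s -> (0 < lam (cyl s))%E.
Proof.
move=> /lebesgue_measure_branch[K [K0 /(_ (Omega R))[]//]] _.
rewrite cyl_preimage_Omega lebesgue_measure_Omega => h.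
rewrite lt_neqAle measure_ge0 andbT; apply/eqP => s0.
by move: h; rewrite -s0 mule0 lee_fin ler10.
Qed.

(** Taking [E = Omega] in [lebesgue_measure_branch] places the measure of the cylinder between
    $1/(4K)$ and $1/K$; substituting this for [K] leaves the constant 4, the same for all
    strings. *)
Lemma lebesgue_measure_distortion s E : positive s -> E `<=` Omega R ->
  (lam (cyl s `&` iter (size s) T @^-1` E) <= 4%:E * lam E * lam (cyl s))%E /\
  (lam E * lam (cyl s) <= 4%:E * lam (cyl s `&` iter (size s) T @^-1` E))%E.
Proof.
move=> /lebesgue_measure_branch[K [K0 h]] EO.
have [up lo] := h _ EO; have [] := h (Omega R); first by [].
rewrite cyl_preimage_Omega lebesgue_measure_Omega mule1.
set c := lam (cyl s); set e := lam E; set a := lam (_ `&` _) in up lo *.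
have c0 : (0 <= c)%E by exact: measure_ge0.
have e0 : (0 <= e)%E by exact: measure_ge0.
move=> cK Kc; split.
  apply: (le_trans up); rewrite [leRHS]muleAC; apply: lee_wpmul2r => //.
  rewrite -[leLHS]mule1 lee_pdivrMl// muleA -EFinM mulrC; exact: Kc.
rewrite muleC; apply: le_trans (lee_wpmul2l _ lo) _ => //.
apply: le_trans (lee_wpmul2r _ cK) _.
  by rewrite mule_ge0 ?measure_ge0// lee_fin; lra.
by rewrite muleA -EFinM mulrCA mulVf ?mulr1 ?gt_eqF.
Qed.

End distortion.

(** * Sets determined by finitely many digits *)

Section determined.
Context {R : realType}.
Implicit Types (s : seq nat) (W : set R) (n : nat).

(** These are the unions of cylinders of rank [n]; the form by digits is the one that is easy to
    verify for sets defined by Birkhoff sums. *)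
Definition determined n W := W `<=` Omega R /\
  forall x y, Omega R x -> Omega R y -> digits n x = digits n y -> W x -> W y.

(** Strings are indexed by their [pickle] codes, which turns the countable union into a sequence;
    indices that code no suitable string receive the empty set. *)
Lemma determined_partition n W : determined n W -> exists F : (set R)^nat,
  [/\ trivIset [set: nat] F, \bigcup_j F j = W &
      forall j, F j = set0 \/
        exists s, [/\ size s = n, positive s, cyl s `<=` W & F j = cyl s]].
Proof.
move=> [WO Wd].
pose good s := `[< [/\ size s = n, positive s & @cyl R s `<=` W] >].
pose F (j : nat) : set R := if @pickle_inv (seq nat) j is Some s then
  if good s then cyl s else set0 else set0.
have Fgood (j : nat) (x : R) : F j x ->
    exists s, [/\ pickle s = j, good s & F j = cyl s].
  rewrite /F; case E: (pickle_inv j) => [s|//]; case: ifPn => // gs _.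
  by exists s; split=> //; have := @pickle_invK (seq nat) j; rewrite E.
exists F; split.
- apply/trivIsetP => i j _ _ /eqP ij; apply/seteqP; split=> // x [Fi Fj].
  have [s [si gs Es]] := Fgood _ _ Fi; have [t [tj gt Et]] := Fgood _ _ Fj.
  apply: ij; rewrite -si -tj; congr (pickle _).
  move: Fi Fj; rewrite Es Et => /digits_cyl + /digits_cyl.
  move: gs gt => /asboolP[-> _ _] /asboolP[-> _ _].
  by move=> <- <-.
- apply/seteqP; split=> [x [j _ /[dup] Fx /Fgood[s [_ /asboolP[_ _ sW] Fs]]]|x Wx].
    by apply: sW; rewrite -Fs.
  exists (pickle (digits n x)) => //; rewrite /F pickleK_inv.
  have Ox := WO _ Wx; rewrite ifT; first exact: cyl_digits.
  apply/asboolP; split; [exact: size_digits|exact: pos_digits|].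
  move=> y sy; apply: (Wd x) => //; first exact: Omega_cyl sy.
  by have := digits_cyl sy; rewrite size_digits => ->.
- move=> j; rewrite /F; case: (pickle_inv j) => [s|]; last by left.
  case: ifPn => [/asboolP[? ? ?]|_]; last by left.
  by right; exists s.
Qed.

Lemma measurable_determined n W : determined n W -> measurable W.
Proof.
move=> /determined_partition[F [_ <- FE]]; apply: bigcup_measurable => j _.
by have [->|[s [_ _ _ ->]]] := FE j; [exact: measurable0|exact: measurable_cyl].
Qed.

(** Countable additivity extends an inequality from cylinders to their unions. It serves to compare
    restrictions of Lebesgue measure with its multiples. *)
Lemma le_measure_determined n W
    (nu1 nu2 : {measure set (measurableTypeR R) -> \bar R}) :
  determined n W ->
  (forall s, size s = n -> positive s -> cyl s `<=` W ->
    (nu1 (cyl s) <= nu2 (cyl s))%E) ->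
  (nu1 W <= nu2 W)%E.
Proof.
move=> /determined_partition[F [tF <- FE]] h.
have mF j : measurable (F j).
  by have [->|[s [_ _ _ ->]]] := FE j; [exact: measurable0|exact: measurable_cyl].
have nuE (nu : {measure set (measurableTypeR R) -> \bar R}) :
    nu (\bigcup_j F j) = (\sum_(0 <= j <oo | j \in setT) nu (F j))%E.
  by apply: measure_bigcup => // j _; exact: mF.
rewrite !nuE.
apply: lee_nneseries => [j _ _|j _]; first exact: measure_ge0.
have [->|[s [ns sp sW ->]]] := FE j; first by rewrite !measure0.
exact: h.
Qed.

Lemma take_digits n m (z : R) : (n <= m)%N -> take n (digits m z) = digits n z.
Proof. by move=> nm; rewrite /digits /mkseq -map_take take_iota (minn_idPl nm). Qed.

Lemma determined_cyl s : determined (size s) (@cyl R s).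
Proof.
split=> [x|x y Ox Oy xy sx]; first exact: Omega_cyl.
by rewrite -(digits_cyl sx) xy; exact: cyl_digits.
Qed.

Lemma determined_Omega n : determined n (Omega R).
Proof. by split. Qed.

End determined.

(** * Uniform bounds for preimages and a density argument on cylinders *)

Section cylinder_density.
Context {R : realType}.
Local Notation lam := (@lebesgue_measure R).
Local Notation T := (@gauss_map R).
Implicit Types (s : seq nat) (E W B : set R) (n : nat).

Lemma lebesgue_measure_Omega_fin E : E `<=` Omega R -> lam E \is a fin_num.
Proof.
move=> EO; rewrite ge0_fin_numE ?measure_ge0//.
apply: (le_lt_trans (le_lebesgue_measure EO)).
by rewrite lebesgue_measure_Omega ltry.
Qed.

(** The distortion bound is summed over all cylinders of rank [n]; its constant does not depend on
    [n]. *)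
Lemma lebesgue_measure_preimage n E : measurable E -> E `<=` Omega R ->
  (lam (Omega R `&` iter n T @^-1` E) <= 4%:E * lam E)%E.
Proof.
move=> mE EO; have mP := measurable_preimage_iter measurable_gauss_map n mE.
have eE : lam E = (fine (lam E))%:E by rewrite fineK// lebesgue_measure_Omega_fin.
have e0 : 0 <= 4 * fine (lam E) by rewrite mulr_ge0// fine_ge0.
have -> : (4%:E * lam E = (4 * fine (lam E))%:E * lam (Omega R))%E.
  by rewrite lebesgue_measure_Omega mule1 EFinM -eE.
apply: (@le_measure_determined R n (Omega R) (mrestr lam mP)
  (mscale (NngNum e0) lam) (determined_Omega n)) => s sn sp _.
suff : (lam (cyl s `&` iter n T @^-1` E) <= (4 * fine (lam E))%:E * lam (cyl s))%E.
  exact.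
rewrite EFinM -eE -sn.
by have [] := lebesgue_measure_distortion sp EO.
Qed.

(** The constant 8 is the distortion 4 times the ratio 2 of the upper to the lower bound of the
    Gauss density. *)
Lemma gauss_preimage n E : measurable E ->
  (gauss (iter n T @^-1` E) <= 8%:E * gauss E)%E.
Proof.
move=> mE; have ln2 : 0 < ln 2 :> R by rewrite ln_gt0// ltr1n.
have mEO := measurableI _ _ mE measurable_Omega.
have mP := measurable_preimage_iter measurable_gauss_map n mE.
apply: (le_trans (gauss_le_lebesgue mP)).
have -> : iter n T @^-1` E `&` Omega R = Omega R `&` iter n T @^-1` (E `&` Omega R).
  rewrite setIC; apply/seteqP; split=> x [Ox]; last by case.
  by move=> Ex; split=> //; split=> //; exact: Omega_iter.
have le1 := lebesgue_measure_preimage n mEO (@subIsetr _ _ _).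
have le2 := lebesgue_le_gauss mE.
have le3 : (4%:E * lam (E `&` Omega R) <= 4%:E * ((2 * ln 2)%:E * gauss E))%E.
  by apply: lee_wpmul2l => //; rewrite lee_fin.
apply: le_trans (lee_wpmul2l _ (le_trans le1 le3)) _.
  by rewrite lee_fin invr_ge0 ltW.
rewrite !muleA -!EFinM.
have -> : (exp.ln 2)^-1 * 4 * (2 * exp.ln 2) = 8 :> R.
  by field; rewrite gt_eqF.
by [].
Qed.

Lemma gauss_eq0 E : measurable E ->
  gauss E = 0%E <-> lam (E `&` Omega R) = 0%E.
Proof.
move=> mE; split=> E0; apply/eqP; rewrite eq_le measure_ge0 andbT.
  by have := lebesgue_le_gauss mE; rewrite E0 mule0.
by have := gauss_le_lebesgue mE; rewrite E0 mule0.
Qed.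

(** The inverse branch contracts by a factor [K >= n]. *)
Lemma cyl_diameter n (x y : R) : (0 < n)%N -> Omega R x -> cyl (digits n x) y ->
  `|x - y| <= n%:R^-1.
Proof.
move=> n0 Ox sy; have sx := cyl_digits n Ox.
have [K [K1 nK up _]] := @branch_distortion R _ (pos_digits n Ox).
rewrite -(branch_iter sx) -(branch_iter sy).
have /andP[a0 a1] := Omega_itv01 (Omega_iter (size (digits n x)) Ox).
have /andP[b0 b1] := Omega_itv01 (Omega_iter (size (digits n x)) (Omega_cyl sy)).
apply: (le_trans (up _ _ _ _)); [by apply/andP|by apply/andP|].
rewrite size_digits in nK; have n0' : 0 < n%:R :> R by rewrite ltr0n.
rewrite -[leRHS]mul1r ler_pM ?invr_ge0//; first by lra.
  by rewrite ler_norml; apply/andP; split; lra.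
by rewrite lef_pV2// posrE; lra.
Qed.

(* Knopp's argument: the cylinders inside an open cover of [Omega `\` B] already
   carry too much of [B] unless that set is null. *)
Lemma cylinder_density B (c : R) : measurable B -> 0 < c ->
  (forall s, positive s -> (c%:E * lam (cyl s) <= lam (cyl s `&` B))%E) ->
  lam (Omega R `\` B) = 0%E.
Proof.
move=> mB c0 Bs; set D := Omega R `\` B.
have mD : measurable D by apply: measurableD => //; exact: measurable_Omega.
have Dfin : (lam D < +oo)%E.
  by rewrite -ge0_fin_numE ?measure_ge0// lebesgue_measure_Omega_fin//; exact: subDsetl.
suff h e : 0 < e -> (c%:E * lam D <= e%:E)%E.
  have [r rE] : exists r, lam D = r%:E.
    by exists (fine (lam D)); rewrite fineK// ge0_fin_numE// measure_ge0.
  have r0 : 0 <= r by rewrite -lee_fin -rE measure_ge0.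
  rewrite rE; congr EFin; apply/eqP; rewrite eq_le r0 andbT leNgt; apply/negP => rp.
  have /h : 0 < c * r / 2 by rewrite divr_gt0// mulr_gt0.
  by rewrite rE -EFinM lee_fin; have := mulr_gt0 c0 rp; lra.
move=> e0; have [U [oU DU UD]] := lebesgue_regularity_outer mD Dfin e0.
have mU : measurable U by exact: open_measurable.
(* [W n] is the union of the cylinders of rank [n] inside [U]. Since cylinders shrink, [W n]
   increases to [U] intersected with [Omega]. *)
pose W n := Omega R `&` [set x | cyl (digits n x) `<=` U].
have dW n : determined n (W n).
  by split=> [x []//|x y Ox Oy xy [_ xU]]; split=> //; rewrite /= -xy.
have mW n : measurable (W n) by exact: measurable_determined (dW n).
have WU : \bigcup_n W n = U `&` Omega R.
  apply/seteqP; split=> x.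
    by move=> [n _ [Ox xU]]; split=> //; apply: xU; exact: cyl_digits.
  move=> [Ux Ox]; have /nbhs_ballP[r /= r0 rU] := open_nbhs_nbhs (conj oU Ux).
  have [n nr] : exists n : nat, n.+1%:R^-1 < r.
    by have [N _ /(_ N (leqnn N)) ?] := near_infty_natSinv_lt (PosNum r0); exists N.
  exists n.+1 => //; split=> // y sy; apply: rU.
  by rewrite /ball /=; apply: le_lt_trans (cyl_diameter _ Ox sy) nr.
have Wc n : (c%:E * lam (W n) <= e%:E)%E.
  have := @le_measure_determined R n (W n) (mscale (NngNum (ltW c0)) lam)
    (mrestr lam mB) (dW n) (fun s _ sp _ => Bs s sp).
  move=> /le_trans; apply.
  (* The part of [W n] inside [B] lies in [U] and misses [D], so its measure is below [e]. *)
  apply: le_trans (ltW UD); apply: le_lebesgue_measure => x [Wx Bx]; split.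
    have : (\bigcup_n W n) x by exists n.
    by rewrite WU => -[].
  by move=> [].
have mWU : measurable (\bigcup_n W n).
  by rewrite WU; apply: measurableI => //; exact: measurable_Omega.
have ndW : {homo W : n m / (n <= m)%N >-> (n <= m)%O}.
  move=> n m nm; apply/subsetPset => x [Ox xU]; split=> // y sy; apply: xU.
  have yx : digits m y = digits m x by have := digits_cyl sy; rewrite size_digits.
  rewrite -(take_digits x nm) -yx take_digits//; exact/cyl_digits/(Omega_cyl sy).
have cvW : lam (W n) @[n --> \oo] --> lam (\bigcup_n W n).
  exact: (@nondecreasing_cvg_mu _ (measurableTypeR R) _ lam W mW mWU ndW).
apply: (@le_trans _ _ (c%:E * lam (\bigcup_n W n))%E).
  apply: lee_wpmul2l; first by rewrite lee_fin ltW.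
  by apply: le_lebesgue_measure => x Dx; rewrite WU; split; [exact: DU|case: Dx].
rewrite -lee_pdivlMl//.
rewrite -(cvg_lim _ cvW)//; apply: lime_le; first exact: cvgP cvW.
by apply: nearW => n; rewrite /= lee_pdivlMl.
Qed.

End cylinder_density.

(** * The skew product *)

Lemma le_measure_bigsetU d (X : measurableType d) (R : realType)
    (mu : {measure set X -> \bar R}) (I : Type) (r : seq I) (F : I -> set X) :
  (forall i, measurable (F i)) ->
  (mu (\big[setU/set0]_(i <- r) F i) <= \sum_(i <- r) mu (F i))%E.
Proof.
move=> mF; elim: r => [|i r IH]; first by rewrite !big_nil measure0.
rewrite !big_cons; apply: le_trans (leeD2l _ IH).
by apply: measureU2 => //; exact: bigsetU_measurable.
Qed.

Section skew_product_dynamics.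
Context {R : realType} {M : finType} (m0 : M) (f : nat -> M -> M).
Local Notation T := (@gauss_map R).
Local Notation S := (skew_map R m0 f).
Local Notation lam := (@lebesgue_measure R).
Local Notation space := (R * discrete m0)%type.
Implicit Types (A E : set space) (s : seq nat) (x : R) (m : M).

Definition transport s m : M := foldl (fun m c => f c m) m s.

Lemma digits_cons n x : digits n.+1 x = first_digit x :: digits n (T x).
Proof.
rewrite /digits /mkseq /= -[1%N]addn0 iotaDl -map_comp; congr (_ :: _).
by apply: eq_map => i /=; rewrite /digit -iterSr add1n.
Qed.

Lemma skew_mapE x m : S (x, m) = (T x, f (first_digit x) m).
Proof. by []. Qed.

Lemma iter_skew_map n x m :
  iter n S (x, m) = (iter n T x, transport (digits n x) m).
Proof.
elim: n x m => // n IH x m.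
by rewrite iterSr skew_mapE IH -iterSr digits_cons.
Qed.

Lemma iter_skew_map_cyl s x m : cyl s x ->
  iter (size s) S (x, m) = (iter (size s) T x, transport s m).
Proof. by move=> sx; rewrite iter_skew_map digits_cyl. Qed.

Lemma Omegat_skew_map z : Omegat R m0 z -> Omegat R m0 (S z).
Proof. by move=> [Oz _]; split=> //; exact: Omega_gauss_map. Qed.

Lemma Omegat_iter n z : Omegat R m0 z -> Omegat R m0 (iter n S z).
Proof. by move=> Oz; elim: n => //= n; exact: Omegat_skew_map. Qed.

Lemma measurable_Omegat : measurable (Omegat R m0).
Proof. by apply: measurableX => //; exact: measurable_Omega. Qed.

Lemma measurable_skew_map : measurable_fun [set: space] S.
Proof.
apply/measurable_fun_pairP; split => /=.
  exact: (measurableT_comp measurable_gauss_map measurable_fst).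
move=> _ Y _; rewrite setTI.
rewrite (_ : _ @^-1` Y = \bigcup_c \bigcup_(m in [set m : discrete m0 | Y (f c m)])
    ([set x : R | first_digit x = c] `*` [set m])).
  apply: bigcup_measurable => c _; apply: fin_bigcup_measurable => [|m _].
    exact: finite_finset.
  by apply: measurableX => //; exact: measurable_first_digit.
apply/seteqP; split=> -[x m] /=.
  by move=> Yx; exists (first_digit x) => //; exists m.
by move=> [c _ [k /= + [/= -> ->]]].
Qed.

Let M_gt0 : (0 < #|M|)%N.
Proof. by apply/card_gt0P; exists m0. Qed.

Let M_gt0R : 0 < #|M|%:R :> R.
Proof. by rewrite ltr0n M_gt0. Qed.

Lemma gausst_Omegat : gausst R m0 (Omegat R m0) = 1%E.
Proof.
rewrite /gausst (eq_bigr (fun=> (#|M|%:R^-1)%:E)) => [|m _].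
  by rewrite sumEFin sumr_const -(mulr_natl (#|M|%:R^-1)) divff// gt_eqF.
rewrite (_ : ysection _ _ = Omega R) ?gauss_Omega ?mule1//.
by rewrite ysectionE; apply/seteqP; split=> x; [case|].
Qed.

Lemma gausst_setIOmegat A : gausst R m0 (A `&` Omegat R m0) = gausst R m0 A.
Proof.
apply: eq_bigr => m _; congr (_ * _)%E; rewrite -[RHS]gauss_setIOmega.
congr gauss; rewrite !ysectionE; apply/seteqP.
by split=> x; [move=> [Ax []]|move=> []].
Qed.

Lemma gausst_setT : gausst R m0 setT = 1%E.
Proof. by rewrite -gausst_setIOmegat setTI gausst_Omegat. Qed.

Lemma gausstE A : gausst R m0 A =
  ((#|M|%:R^-1)%:E * \sum_(m : M) gauss (ysection A m : set R))%E.
Proof. by rewrite ge0_sume_distrr. Qed.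

(** Where the second coordinate ends up depends on the digits. Each section of the preimage is
    therefore bounded by the union of the preimages of all sections of [A], which costs the factor
    [#|M|] on top of [gauss_preimage]. *)
Lemma gausst_preimage n A : measurable A ->
  (gausst R m0 (iter n S @^-1` A) <= (8 * #|M|%:R)%:E * gausst R m0 A)%E.
Proof.
move=> mA.
have mY m : measurable (ysection A m : set R) by exact: measurable_ysection.
pose Z := (\sum_(m : M) gauss (ysection A m : set R))%E.
have le1 m : (gauss (ysection (iter n S @^-1` A) m : set R) <= 8%:E * Z)%E.
  apply: (@le_trans _ _
      (gauss (\big[setU/set0]_(k : M) (iter n T @^-1` ysection A k)))).
    apply: le_measure; rewrite ?inE.
    - apply: measurable_ysection.
      exact: (measurable_preimage_iter measurable_skew_map).
    - apply: bigsetU_measurable => k _.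
      exact: (measurable_preimage_iter measurable_gauss_map).
    - move=> x /ysectionP; rewrite /preimage /= iter_skew_map => Ax.
      rewrite -bigcup_seq; exists (transport (digits n x) m); last exact/ysectionP.
      by rewrite /= mem_index_enum.
  apply: le_trans (le_measure_bigsetU _ _ _) _.
    by move=> k; exact: (measurable_preimage_iter measurable_gauss_map).
  rewrite /Z ge0_sume_distrr//; apply: lee_sum => k _.
  exact: gauss_preimage.
have [z zE] : exists z, Z = z%:E.
  exists (fine Z); rewrite fineK//; apply/sum_fin_numP => m _ _.
  exact: gauss_fin_num.
rewrite !gausstE -/Z muleA -EFinM -mulrA divff ?gt_eqF// mulr1.
rewrite muleC lee_pdivrMr//.
apply: (@le_trans _ _ (\sum_(m : M) (8%:E * Z))%E); first by apply: lee_sum => m _.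
by rewrite zE -EFinM sumEFin sumr_const -(mulr_natr (8 * z)).
Qed.

Lemma gausst_eq0 A : measurable A -> gausst R m0 A = 0%E <->
  forall m : M, lam (ysection A m `&` Omega R) = 0%E.
Proof.
move=> mA; have mY m : measurable (ysection A m : set R) by exact: measurable_ysection.
split=> [A0 m|A0].
  apply/gauss_eq0 => //; apply/eqP; move: A0 => /eqP.
  rewrite /gausst (bigD1 m)//= padde_eq0; last 2 first.
  - by rewrite mule_ge0// lee_fin invr_ge0.
  - by apply: sume_ge0 => k _; rewrite mule_ge0// lee_fin invr_ge0.
  by move=> /andP[]; rewrite mule_eq0 eqe invr_eq0 gt_eqF.
rewrite /gausst big1// => m _.
by have /gauss_eq0 -> // := A0 m; rewrite mule0.
Qed.

(** The combinatorial content of transitivity: digit strings connect any two elements of [M]. It is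
    read off at the second coordinate above one point of [Omega]. *)
Lemma transitive_transport : skew_transitive R m0 f -> forall m1 m2,
  exists2 s, positive s & transport s m1 = m2.
Proof.
move=> tr m1 m2; have [s /andP[_ sp] Es] := tr m1 m2; exists s => //.
have /set0P[y Oy] : Omega R != set0.
  by apply/eqP => O0; have := @lebesgue_measure_Omega R;
    rewrite O0 measure0 => /eqP; rewrite eq_sym onee_eq0.
have : (Omega R `*` [set m2 : discrete m0]) (y, m2) by [].
rewrite -Es => -[[x m] [sx mE]]; rewrite /= in mE; rewrite mE iter_skew_map_cyl//.
by move=> [_].
Qed.

(** If [E] is not null, transitivity and distortion make all its sections positive. With [k] the
    least of their measures, invariance and distortion give every section at least the fraction
    [k / 4] of every cylinder, so [cylinder_density] makes the complement null. *)
Lemma zero_one E : skew_transitive R m0 f -> measurable E ->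
  (forall z, Omegat R m0 z -> E (S z) <-> E z) ->
  gausst R m0 E = 0%E \/ gausst R m0 (~` E) = 0%E.
Proof.
move=> /transitive_transport tr mE invE.
have mY m : measurable (ysection E m : set R) by exact: measurable_ysection.
have [E0|nE0] := pselect (gausst R m0 E = 0%E); [by left|right].
pose e m := lam (ysection E m `&` Omega R).
have invn n z : Omegat R m0 z -> E (iter n S z) <-> E z.
  move=> Oz; elim: n => //= n [IH1 IH2]; have [h1 h2] := invE _ (Omegat_iter n Oz).
  by split=> [/h1|/IH2/h2].
(* By invariance, on a cylinder the section over [m] is the pull-back of the section over
   [transport s m]. *)
have fiber s m : cyl s `&` ysection E m =
    cyl s `&` iter (size s) T @^-1` (ysection E (transport s m) `&` Omega R).
  apply/seteqP; split=> x [sx]; have Ox := Omega_cyl sx;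
      have [h1 h2] := invn (size s) (x, m) (conj Ox I);
      rewrite iter_skew_map_cyl// in h1 h2.
    by move=> /ysectionP/h2 Es; split=> //; split; [exact/ysectionP|exact: Omega_iter].
  by move=> -[/ysectionP/h1 Ex _]; split=> //; exact/ysectionP.
have [m1 em1] : exists m, e m != 0%E.
  apply: contrapT => h; apply: nE0; apply/gausst_eq0 => // m; apply/eqP.
  by apply: contrapT => em; apply: h; exists m; apply/negP.
have e_fin m : e m \is a fin_num.
  by apply: lebesgue_measure_Omega_fin; exact: subIsetr.
have e_gt0 m : (0 < e m)%E.
  (* A string leading from [m] to [m1] pulls the positive section over [m1] back into the section
     over [m]. *)
  have [s sp sm] := tr m m1.
  have [_] := lebesgue_measure_distortion sp (@subIsetr _ (ysection E m1) (Omega R)).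
  rewrite -/(e m1) -{2}sm -fiber => lo.
  have : (0 < e m1 * lam (cyl s))%E.
    by rewrite mule_gt0 ?lebesgue_measure_cyl_gt0// lt_def em1 measure_ge0.
  move=> /lt_le_trans/(_ lo); rewrite pmule_rgt0// => /lt_le_trans; apply.
  apply: le_lebesgue_measure => x [sx Ex]; split=> //; exact: Omega_cyl sx.
have [i _ ei] := @arg_minP _ _ M m1 xpredT (fun m => fine (e m)) isT.
set k := fine (e i) in ei.
have k0 : 0 < k by rewrite fine_gt0// e_gt0 ltey_eq e_fin.
have ke m : (k%:E <= e m)%E by rewrite -[e m]fineK// lee_fin ei.
apply/gausst_eq0; first exact: measurableC.
move=> m.
have k4 : 0 < 4^-1 * k by rewrite mulr_gt0.
have := cylinder_density (mY m) k4.
rewrite (_ : ysection (~` E) m `&` Omega R = Omega R `\` ysection E m); last first.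
  by rewrite !ysectionE setIC.
apply=> s sp; rewrite EFinM -muleA lee_pdivrMl// fiber.
have [_ lo] := lebesgue_measure_distortion sp
  (@subIsetr _ (ysection E (transport s m)) (Omega R)).
by apply: (le_trans _ lo); apply: lee_wpmul2r; [exact: measure_ge0|exact: ke].
Qed.

End skew_product_dynamics.

(** * Visits of a CF-normal orbit to sets determined by finitely many digits *)

Section cf_normal_frequency.
Context {R : realType}.
Local Notation T := (@gauss_map R).

Lemma sum_indic_trivIset (F : (set R)^nat) J y : trivIset [set: nat] F ->
  \sum_(j < J) \1_(F j) y <= \1_(\bigcup_j F j) y :> R.
Proof.
move=> tF; have [[j0 _ Fj0]|nF] := pselect ((\bigcup_j F j) y); last first.
  rewrite big1 ?indicE// => j _; rewrite indicE memNset// => Fj.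
  by apply: nF; exists (j : nat).
rewrite [leRHS]indicE mem_set; last by exists j0.
have F0 (j : nat) : j != j0 -> \1_(F j) y = 0 :> R.
  move=> jj0; rewrite indicE memNset// => Fj; move/eqP: jj0; apply.
  by apply: tF => //; exists y.
have [j0J|Jj0] := ltnP j0 J.
  rewrite (bigD1 (Ordinal j0J))//= big1 ?addr0.
    by rewrite indicE; case: (_ \in _).
  by move=> j jj0; apply: F0.
rewrite big1// => j _; apply: F0; apply/eqP => jE.
by have := ltn_ord j; rewrite jE ltnNge Jj0.
Qed.

Lemma determinedD n W : determined n W -> determined n (Omega R `\` W).
Proof.
move=> [WO Wd]; split=> [x []//|x y Ox Oy xy [_ nW]]; split=> // Wy.
by apply: nW; apply: (Wd y).
Qed.

(** Normality controls only finitely many cylinders at once, so the upper bound for [W] comes from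
    its complement: finitely many cylinders there carry Gauss measure above [1 - w - e / 2], and the
    orbit visits them with frequency eventually above [1 - w - e]. The condition [0 < n] keeps the
    strings nonempty, as [cf_normal] requires. *)
Lemma frequency_determined n W (x : R) (w e : R) : (0 < n)%N -> determined n W ->
  cf_normal x -> gauss W = w%:E -> 0 < e ->
  \forall N \near \oo, frequency R T x W N <= w + e.
Proof.
move=> n0 dW nx wE e0.
have [F [tF UF FE]] := determined_partition (determinedD dW).
have mF j : measurable (F j).
  by have [->|[s [_ _ _ ->]]] := FE j; [exact: measurable0|exact: measurable_cyl].
pose g j : R := fine (gauss (F j)).
have gE j : gauss (F j) = (g j)%:E by rewrite fineK//; exact: gauss_fin_num.
have cvF j : frequency R T x (F j) N @[N --> \oo] --> g j.
  apply: (@fine_cvg _ _ _ _ (fun N => (frequency R T x (F j) N)%:E)).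
  rewrite -gE; have [->|[s [sn sp _ ->]]] := FE j.
    rewrite measure0 (_ : (fun _ => _) = cst 0%E); first exact: cvg_cst.
    apply/funext => N; rewrite frequencyE /birkhoff big1 ?mul0r// => i _.
    by rewrite indic0.
  by apply: nx; rewrite /positive_string sp andbT -size_eq0 sn -lt0n.
have mW := measurable_determined dW.
have gV : gauss (Omega R `\` W) = (1 - w)%:E.
  have mV := measurable_determined (determinedD dW).
  have : gauss (Omega R) = (gauss W + gauss (Omega R `\` W))%E.
    rewrite -[in LHS](setDUK (proj1 dW)).
    exact: (measureU gauss mW mV (setDIK _ _)).
  have -> : gauss (Omega R `\` W) = (fine (gauss (Omega R `\` W)))%:E.
    by rewrite fineK//; exact: gauss_fin_num.
  by rewrite gauss_Omega wE -EFinD => -[h]; congr EFin; lra.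
have cvg_g : (\sum_(0 <= j < J) g j) @[J --> \oo] --> 1 - w.
  apply: (@fine_cvg _ _ _ _ (fun J => (\sum_(0 <= j < J) g j)%:E)).
  rewrite -gV -UF.
  have -> : (fun J => (\sum_(0 <= j < J) g j)%:E) =
      (fun J => \sum_(0 <= j < J) gauss (F j))%E.
    by apply/funext => J; rewrite -sumEFin; apply: eq_bigr => j _; rewrite gE.
  exact: (@measure_semi_sigma_additive _ _ _ gauss F mF tF
    (bigcup_measurable (fun j _ => mF j))).
have [J _ /(_ J (leqnn J)) hJ] :
    \forall J \near \oo, 1 - w - e / 2 < \sum_(0 <= j < J) g j.
  by apply: (cvgr_gt _ cvg_g); lra.
have cvJ : (\sum_(0 <= j < J) frequency R T x (F j) N) @[N --> \oo] -->
    \sum_(0 <= j < J) g j.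
  by apply: cvg_big => [|j _]; [exact: add_continuous|exact: cvF].
have : \forall N \near \oo, 1 - w - e < \sum_(0 <= j < J) frequency R T x (F j) N.
  by apply: (cvgr_gt _ cvJ); lra.
apply: filterS => N hN.
suff : frequency R T x W N + \sum_(0 <= j < J) frequency R T x (F j) N <= 1 by lra.
under eq_bigr do rewrite frequencyE.
rewrite frequencyE -mulr_suml -mulrDl.
(* For [N = 0] division by zero makes the frequencies 0. *)
have [->|N0] := posnP N; first by rewrite invr0 mulr0.
rewrite ler_pdivrMr ?ltr0n// mul1r /birkhoff exchange_big /= -big_split /=.
rewrite -[N in leRHS]card_ord -sumr_const; apply: ler_sum => i _.
set y := iter i T x; rewrite big_mkord.
apply: le_trans (lerD (lexx _) (sum_indic_trivIset J y tF)) _.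
rewrite UF !indicE; have [Wy|nWy] := pselect (W y).
  by rewrite mem_set// memNset ?addr0// => -[].
by rewrite (memNset nWy) add0r; case: (_ \in _).
Qed.

End cf_normal_frequency.

(** * Upper frequency bounds for the skew product *)

Section normality.
Context {R : realType} {M : finType} (m0 : M) (f : nat -> M -> M).
Local Notation T := (@gauss_map R).
Local Notation S := (skew_map R m0 f).
Local Notation space := (R * discrete m0)%type.

HB.instance Definition _ :=
  Measure_isProbability.Build _ _ _ (gausst R m0) (gausst_setT m0).

(** The first [k] digits decide membership over each fixed second coordinate. Containment in
    [Omegat] is not part of it, so the class is closed under complement. *)
Definition skew_determined k (A : set space) := forall (y y' : R) (m : M),
  Omega R y -> Omega R y' -> digits k y = digits k y' -> A (y, m) -> A (y', m).

Lemma skew_determinedC k A : skew_determined k A -> skew_determined k (~` A).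
Proof. by move=> Ad y y' m Oy Oy' yy' nA Ay'; apply: nA; apply: (Ad y'). Qed.

Lemma digits_add i k (x : R) : digits (i + k) x = digits i x ++ digits k (iter i T x).
Proof.
by elim: i x => // i IH x; rewrite addSn !digits_cons IH /= -iterSr.
Qed.

(** The visit at time [i < n] depends on the [k] digits after position [i], and on the first [i]
    digits through [transport]. *)
Lemma birkhoff_skew_determined k A n (y y' : R) (m : M) : skew_determined k A ->
  Omega R y -> Omega R y' -> digits (n + k) y = digits (n + k) y' ->
  birkhoff S A n (y, m) = birkhoff S A n (y', m) :> R.
Proof.
move=> Ad Oy Oy' yy'; apply: eq_bigr => i _; rewrite !iter_skew_map.
have : digits (i + k) y = digits (i + k) y'.
  have ik : (i + k <= n + k)%N by rewrite leq_add2r ltnW.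
  by rewrite -(take_digits y ik) yy' take_digits.
rewrite !digits_add => /eqP; rewrite eqseq_cat ?size_digits// => /andP[/eqP -> /eqP h].
rewrite !indicE; congr (nat_of_bool _)%:R; apply/idP/idP; rewrite !inE => Ai.
  by apply: Ad Ai => //; exact: Omega_iter.
by apply: Ad Ai => //; exact: Omega_iter.
Qed.

Lemma measurable_skew_birkhoff_gt A n (r : R) : measurable A ->
  measurable [set z | r < birkhoff S A n z].
Proof.
move=> mA; have mS := @measurable_skew_map R M m0 f.
by have := @measurable_birkhoff_gt _ _ R _ mS A n r mA.
Qed.

Variables (rho : probability space R) (C : R).
Hypothesis tr : skew_transitive R m0 f.
Hypothesis rho_inv : forall A, measurable A -> rho (S @^-1` A) = rho A.
Hypothesis rho_le : forall A, measurable A -> (rho A <= C%:E * gausst R m0 A)%E.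

Lemma rho_null A : measurable A -> gausst R m0 A = 0%E -> rho A = 0%E.
Proof.
move=> mA A0; apply/eqP; rewrite eq_le measure_ge0 andbT.
by have := rho_le mA; rewrite A0 mule0.
Qed.

Lemma rho_conull A : measurable A -> gausst R m0 (~` A) = 0%E -> rho A = 1%E.
Proof.
move=> mA A0; rewrite -[A]setCK probability_setC; last exact: measurableC.
by rewrite rho_null ?sube0//; exact: measurableC.
Qed.

(** The points where [birkhoff S A n z - q * n] is unbounded above in [n]. Asking for every [K]
    makes the set invariant, since one step changes the excess by a bounded amount. *)
Let unbounded A (q : R) : set space :=
  [set z | forall K : nat, exists n, q * n%:R + K%:R < birkhoff S A n z].

(** By the zero-one law the set would otherwise have full [rho]-measure, and [frequent_visits] would
    give [q <= rho A]. *)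
Lemma unbounded_excess A (q : R) : measurable A -> (rho A < q%:E)%E ->
  measurable (unbounded A q) /\ gausst R m0 (unbounded A q) = 0%E.
Proof.
move=> mA Aq.
have q0 : 0 <= q by rewrite -lee_fin (le_trans _ (ltW Aq)).
have mU : measurable (unbounded A q).
  rewrite (_ : unbounded A q = \bigcap_K \bigcup_n
      [set z | q * n%:R + K%:R < birkhoff S A n z]); last first.
    apply/seteqP; split=> z h K; first by have [n] := h K; exists n.
    by have [n _] := h K I; exists n.
  apply: bigcap_measurable => // K _; apply: bigcup_measurable => n _.
  exact: measurable_skew_birkhoff_gt.
have invU z : Omegat R m0 z -> unbounded A q (S z) <-> unbounded A q z.
  have ind0 y : 0 <= (\1_A y : R) <= 1.
    by rewrite indicE; case: (_ \in _); rewrite ?lexx ?ler01.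
  move=> _; split=> h K.
    (* The extra [(Num.truncn q).+1] exceeds [q], the price of one more step; in the converse
       direction [K.+1] absorbs the indicator at [z] and rules out [n = 0]. *)
    have [n hn] := h (K + (Num.truncn q).+1)%N; exists n.+1; rewrite birkhoffS.
    have := truncnS_gt q; have /andP[] := ind0 z.
    by move: hn; rewrite natrD -[n.+1]addn1 natrD; lra.
  have [[|n]] := h K.+1.
    by rewrite mulr0 birkhoff0 add0r ltNge ler0n.
  move=> hn; exists n; move: hn; rewrite birkhoffS; have /andP[] := ind0 z.
  by rewrite -[n.+1]addn1 -[K.+1]addn1 !natrD; lra.
have [//|U1] := zero_one tr mU invU.
have := @frequent_visits _ _ _ rho S (@measurable_skew_map R M m0 f) rho_inv A q mA q0.
have mV : measurable [set z | exists n, q * n%:R < birkhoff S A n z].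
  rewrite (_ : [set z | _] = \bigcup_n [set z | q * n%:R < birkhoff S A n z]).
    apply: bigcup_measurable => n _.
    exact: measurable_skew_birkhoff_gt.
  by apply/seteqP; split=> z; [move=> [n]; exists n|move=> [n _]; exists n].
have -> : rho [set z | exists n, q * n%:R < birkhoff S A n z] = 1%E.
  apply/eqP; rewrite eq_le probability_le1//=.
  rewrite -(rho_conull mU U1); apply: le_measure; rewrite ?inE//.
  by move=> z /(_ 0%N)[n]; rewrite addr0; exists n.
by move=> /(_ erefl); rewrite leNgt Aq.
Qed.

(** Bounds the base points that are bad for some second coordinate. *)
Lemma gausst_section_le (B : set space) : measurable B ->
  (gauss (\big[setU/set0]_(m : M) ysection B m) <= #|M|%:R%:E * gausst R m0 B)%E.
Proof.
move=> mB; apply: le_trans (le_measure_bigsetU _ _ _) _.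
  by move=> m; exact: measurable_ysection.
rewrite gausstE muleA -EFinM divff ?mul1e// pnatr_eq0 -lt0n.
by apply/card_gt0P; exists m0.
Qed.

(** Let [W] be the base points over which, for some second coordinate, the average over a block of
    length [n] exceeds [q + e']. [W] is small and determined by [n + k] digits, so the CF-normal
    orbit of [x] meets it rarely. Averaging block sums along the orbit gives the bound. *)
Lemma frequency_le k A (q e x : R) (m : M) : measurable A -> skew_determined k A ->
  (rho A < q%:E)%E -> 0 < e -> Omega R x -> cf_normal x ->
  \forall N \near \oo, frequency R S (x, m) A N <= q + e.
Proof.
move=> mA Ad Aq e0 Ox nx.
have [mU U0] := unbounded_excess mA Aq.
have q0 : 0 <= q by rewrite -lee_fin (le_trans _ (ltW Aq)).
have M0 : 0 < #|M|%:R :> R by rewrite ltr0n; apply/card_gt0P; exists m0.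
pose H K := [set z | exists n, q * n%:R + K%:R < birkhoff S A n z].
have mH K : measurable (H K).
  rewrite (_ : H K = \bigcup_n [set z | q * n%:R + K%:R < birkhoff S A n z]).
    apply: bigcup_measurable => n _.
    exact: measurable_skew_birkhoff_gt.
  by apply/seteqP; split=> z; [move=> [n]; exists n|move=> [n _]; exists n].
have UE : unbounded A q = \bigcap_K H K.
  by apply/seteqP; split=> z h K; [move=> _; exact: h|exact: h].
(* One share of [e'] each goes to the excess of the block average over [q], to the measure of [W],
   to the error in the frequency of [W], and to the boundary term [n / N]. *)
pose e' := e / 4; have e'0 : 0 < e' by rewrite divr_gt0.
have [K HK] : exists K, (gausst R m0 (H K) < (e' / #|M|%:R)%:E)%E.
  have cH : gausst R m0 (H K) @[K --> \oo] --> 0%E.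
    rewrite -U0 UE; apply: nonincreasing_cvg_mu => //.
    - by rewrite ltey_eq fin_num_measure.
    - exact: bigcap_measurable.
    - move=> i j ij; apply/subsetPset => z [n hn]; exists n; apply: le_lt_trans hn.
      by rewrite lerD2l ler_nat.
  have /fine_cvg cH' : gausst R m0 (H K) @[K --> \oo] --> (0 : R)%:E by [].
  have e'M : 0 < e' / #|M|%:R by rewrite divr_gt0.
  have [K _ /(_ K (leqnn K)) hK] := cvgr_lt _ cH' _ e'M.
  by exists K; rewrite -[X in (X < _)%E]fineK ?lte_fin// fin_num_measure.
(* With [K <= e' * n], a block sum above [(q + e') * n] exceeds [q * n + K], so [W] lies in the
   union of the sections of [H K]. *)
pose n := (Num.truncn (K%:R / e')).+1.
have Kn : K%:R <= e' * n%:R.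
  by have := ltW (truncnS_gt (K%:R / e')); rewrite ler_pdivrMr// mulrC.
pose W := Omega R `&` [set y | exists m : M, (q + e') * n%:R < birkhoff S A n (y, m)].
have dW : determined (n + k) W.
  split=> [y []//|y y' Oy Oy' yy' [_ [l hl]]]; split=> //; exists l.
  by rewrite -(birkhoff_skew_determined _ Ad Oy Oy' yy').
have mW := measurable_determined dW.
have [w [wE we]] : exists w, gauss W = w%:E /\ w <= e'.
  exists (fine (gauss W)); rewrite fineK ?gauss_fin_num//; split=> //.
  rewrite -lee_fin fineK ?gauss_fin_num//.
  apply: (@le_trans _ _ (gauss (\big[setU/set0]_(m : M) ysection (H K) m))).
    apply: le_measure; rewrite ?inE//.
      by apply: bigsetU_measurable => l _; exact: measurable_ysection.
    move=> y [Oy [l hl]]; rewrite -bigcup_seq; exists l.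
      by rewrite /= mem_index_enum.
    by apply/ysectionP; exists n; apply: le_lt_trans hl; rewrite mulrDl lerD2l.
  apply: (le_trans (gausst_section_le (mH K))).
  by rewrite muleC -lee_pdivlMr// -EFinM ltW.
have fW := frequency_determined (n := n + k) isT dW nx wE e'0.
have fn : \forall N \near \oo, n%:R / N%:R <= e'.
  exists (Num.truncn (n%:R / e')).+1 => // N /= hN.
  have N0 : 0 < N%:R :> R by rewrite ltr0n (leq_trans _ hN).
  rewrite ler_pdivrMr// mulrC -ler_pdivrMr// ltW//.
  by apply: lt_le_trans (truncnS_gt _) _; rewrite ler_nat.
near=> N.
have N0 : (0 < N)%N by near: N; exact: nbhs_infty_gt.
have : frequency R T x W N <= w + e' by near: N.
have : n%:R / N%:R <= e' by near: N.
have NR : 0 < N%:R :> R by rewrite ltr0n.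
have nR : 0 < n%:R :> R by rewrite ltr0n.
rewrite !frequencyE => h1 h2.
have : n%:R * birkhoff S A N (x, m) <=
    n%:R ^+ 2 + n%:R * (N%:R * (q + e') + birkhoff T W N x).
  apply: le_trans (birkhoff_average _ _ _ _ _) _; rewrite lerD2l.
  have -> : N%:R * (q + e') + birkhoff T W N x =
      \sum_(j < N) (q + e' + \1_W (iter j T x)).
    by rewrite big_split /= sumr_const card_ord mulr_natl.
  rewrite mulr_sumr.
  apply: ler_sum => j _; rewrite -/(birkhoff S A n _) iter_skew_map.
  have Oj := Omega_iter j Ox; rewrite indicE.
  (* At times in [W] the trivial bound [n] on the block sum suffices; at other times the sum is at
     most [(q + e') * n] for every second coordinate. *)
  have [Wj|nWj] := pselect (W (iter j T x)).
    rewrite mem_set//= mulrDr mulr1.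
    have := birkhoff_le (R := R) S A n (iter j T x, transport f (digits j x) m).
    by move=> /le_trans; apply; rewrite lerDr mulr_ge0 ?addr_ge0// ltW.
  rewrite memNset//= addr0 mulrC leNgt; apply/negP => hj; apply: nWj.
  by split=> //; exists (transport f (digits j x) m).
rewrite expr2 -mulrDr ler_pM2l// => h3.
have : birkhoff S A N (x, m) / N%:R <= n%:R / N%:R + (q + e') + birkhoff T W N x / N%:R.
  rewrite ler_pdivrMr// !mulrDl -[leRHS]addrA !divfK ?gt_eqF//.
  by move: h3; rewrite mulrC; lra.
by move: h1 h2 we; rewrite /e'; lra.
Unshelve. all: by end_near.
Qed.

End normality.

(** * Existence, ergodicity and normality *)

Theorem theorem3p1 (R : realType) (M : finType) (m0 : M) (f : nat -> M -> M) :
  skew_transitive R m0 f ->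
  exists rho : probability (R * discrete m0)%type R,
    [/\ rho (Omegat R m0) = 1%E,
        rho `<< gausst R m0,
        preserves (skew_map R m0 f) rho,
        ergodic (skew_map R m0 f) rho &
        forall x : R, Omega R x -> cf_normal x ->
          forall m : M, skew_normal f rho (x, m)].
Proof.
move=> tr; pose S := skew_map R m0 f.
have mS : measurable_fun setT S := @measurable_skew_map R M m0 f.
have [rho [rho_inv rho_le]] := invariant_measure (P := gausst R m0) mS
  (fun n A mA => gausst_preimage f n mA).
have mO := @measurable_Omegat R M m0.
have rhoO : rho (Omegat R m0) = 1%E.
  apply: (rho_conull rho_le mO).
  by rewrite -gausst_setIOmegat setICl measure0.
(* [rho] is built on the whole product space; being concentrated on [Omegat], it turns invariance
   there into [preserves]. *)
have rhoI A : measurable A -> rho (Omegat R m0 `&` A) = rho A.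
  move=> mA; apply: (etrans _ (esym (measureDI rho mA mO))).
  rewrite setIC -[LHS]add0e; congr (_ + _)%E; apply/esym.
  apply: (rho_null rho_le); first exact: measurableD.
  by rewrite -gausst_setIOmegat setDE -setIA setICl setI0 measure0.
exists rho; split=> //.
- apply/null_content_dominatesP => A mA A0; exact: (rho_null rho_le).
- split; first exact: measurable_funS mS.
  move=> A mA _; rewrite -(rho_inv _ mA) rhoI//.
  by rewrite -[X in measurable X]setTI; exact: mS.
- move=> A mA AO AE.
  have invA z : Omegat R m0 z -> A (S z) <-> A z.
    move=> Oz; split=> [Sz|]; first by rewrite -AE; split.
    by rewrite -{1}AE => -[].
  have [A0|A1] := zero_one tr mA invA; [left|right].
    exact: (rho_null rho_le).
  exact: (rho_conull rho_le).
- move=> x Ox nx m s m' /andP[_ sp].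
  set A := cylt R m0 s m'.
  have mA : measurable A by apply: measurableX => //; exact: measurable_cyl.
  have Ad : skew_determined (size s) A.
    move=> y y' l Oy Oy' yy' [sy lm]; split=> //=.
    exact: (proj2 (determined_cyl s) _ _ Oy Oy' yy').
  have [a aE] : exists a, rho A = a%:E.
    by exists (fine (rho A)); rewrite fineK// fin_num_measure.
  rewrite aE; apply: cvg_EFin; first exact: nearW.
  apply/cvgrPdist_le => e e0 /=.
  have e2 : 0 < e / 2 by rewrite divr_gt0.
  have up : \forall N \near \oo, frequency R S (x, m) A N <= a + e / 2 + e / 2.
    by apply: (frequency_le tr rho_inv rho_le m mA Ad) => //; rewrite aE lte_fin; lra.
  (* The upper bound for the complement, of measure [1 - a], is the lower bound for [A]. *)
  have lo : \forall N \near \oo,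
      frequency R S (x, m) (~` A) N <= 1 - a + e / 2 + e / 2.
    apply: (frequency_le tr rho_inv rho_le m (measurableC mA)
      (skew_determinedC Ad)) => //.
    by rewrite probability_setC// aE -EFinB lte_fin; lra.
  near=> N.
  have N0 : (0 < N)%N by near: N; exact: nbhs_infty_gt.
  have : frequency R S (x, m) A N <= a + e / 2 + e / 2 by near: N.
  have : frequency R S (x, m) (~` A) N <= 1 - a + e / 2 + e / 2 by near: N.
  rewrite !frequencyE birkhoffC mulrBl divff ?pnatr_eq0 -?lt0n//.
  by move=> h1 h2; rewrite ler_norml; apply/andP; split; lra.
Unshelve. all: by end_near.
Qed.
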